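(* Let $n\geq 2$ be an integer, let $f:\mathbb{R}^n\to\mathbb{R}$ be a function, and let $C_f$ be the set of points $x\in\mathbb{R}^n$ such that $\partial^n f(x)\neq\emptyset$ and $Df(x)=0$. Then $\mathcal{L}^1\bigl(f(C_f)\bigr)=0$. The same statement holds true if $\mathbb{R}^n$ is replaced with an open subset of $\mathbb{R}^n$.
   Context: $\mathcal{L}^1$ denotes Lebesgue outer measure on $\mathbb{R}$, and $\mathcal{P}(^n\mathbb{R}^N)$ denotes the space of $n$-homogeneous polynomials $\mathbb{R}^N\to\mathbb{R}$. For an integer $n\ge 2$, a function $f:\mathbb{R}^N\to\mathbb{R}$ has a Taylor expansion of order $n-1$ at $x$ if there exist $k$-homogeneous polynomials $P_x^k$, $k=1,\dots,n-1$, such that $$\lim_{h\to 0}\frac{f(x+h)-f(x)-P_x^1(h)-P_x^2(h)-\dots-P_x^{n-1}(h)}{|h|^{n-1}}=0.$$ Such polynomials are unique when they exist; in that case $f$ is differentiable at $x$ with $Df(x)=P_x^1$. If $f$ has a Taylor expansion of order $n-1$ at $x$, then $\partial^n f(x)$ is the set of all $Q\in\mathcal{P}(^n\mathbb{R}^N)$ such that $$\liminf_{h\to 0}\frac{f(x+h)-f(x)-Df(x)(h)-P_x^2(h)-\dots-P_x^{n-1}(h)-Q(h)}{|h|^n}\geq 0.$$ If $f$ has no Taylor expansion of order $n-1$ at $x$, then $\partial^n f(x)=\emptyset$. In particular $\partial^n f(x)\ne\emptyset$ implies that $Df(x)$ exists. (The theorem uses this with $N=n$.) *)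

(* Defs.v *)
From HB Require Import structures.
From mathcomp Require Import all_boot all_order all_algebra.
From mathcomp Require Import all_classical all_reals all_analysis.
(* The notations of [mpoly] clash with those of the analysis library. *)
From mathcomp Require Import -(notations) mpoly.

Set Implicit Arguments.
Unset Strict Implicit.
Unset Printing Implicit Defensive.

Import Order.TTheory GRing.Theory Num.Theory.
Import numFieldNormedType.Exports.

Local Open Scope classical_set_scope.
Local Open Scope ring_scope.

(* The norm the library puts on ['rV[R]_N] is the sup norm. *)
Definition eucl_norm (R : realType) (N : nat) (h : 'rV[R]_N) : R :=
  Num.sqrt (\sum_(i < N) h 0 i ^+ 2).

(* The zero polynomial belongs to every [homog_poly k]. *)
Definition homog_poly (R : realType) (N k : nat) : set ('rV[R]_N -> R) :=
  [set P | exists2 p : mpoly N R,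
      p \is ishomog1 k mdeg
    & P = (fun h : 'rV[R]_N => meval (fun i => h 0 i) p)].

(* Only the values [P 1], ..., [P m] of the family [P] are relevant. *)
Definition taylor_expansion (R : realType) (N : nat) (f : 'rV[R]_N -> R)
    (m : nat) (x : 'rV[R]_N) (P : nat -> 'rV[R]_N -> R) : Prop :=
  (forall k, (1 <= k <= m)%N -> homog_poly k (P k)) /\
  (f (x + h) - f x - \sum_(1 <= k < m.+1) P k h) / eucl_norm h ^+ m
    @[h --> (0 : 'rV[R]_N)^'] --> (0 : R).

(* Since the polynomials of a Taylor expansion are unique, the existential
   quantifier on [P] introduces no ambiguity; [P 1] is [Df(x)]. *)
Definition subdiff (R : realType) (N n : nat) (f : 'rV[R]_N -> R)
    (x : 'rV[R]_N) : set ('rV[R]_N -> R) :=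
  [set Q | homog_poly n Q /\
    exists2 P : nat -> 'rV[R]_N -> R,
        taylor_expansion f n.-1 x P
      & (0 <= limf_einf
          (fun h : 'rV[R]_N =>
             ((f (x + h) - f x - \sum_(1 <= k < n) P k h - Q h)
                / eucl_norm h ^+ n)%:E) (0 : 'rV[R]_N)^'%R)%E].

Definition subdiff_critical (R : realType) (N n : nat) (f : 'rV[R]_N -> R) :
    set 'rV[R]_N :=
  [set x | subdiff n f x !=set0 /\
    differentiable f x /\ 'd f x = cst 0 :> ('rV[R]_N -> R)].

(* All the notions above are local, so for a function [f] on an open set [U]
   they may be evaluated, at points of [U], on the extension of [f] by 0. *)
Definition subdiff_critical_on (R : realType) (N n : nat) (U : set 'rV[R]_N)
    (f : U -> R) : set U :=
  [set u | subdiff_critical n ('valL_0 f) (val u)].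

Definition lebesgue_outer_measure (R : realType) : set R -> \bar R :=
  mu_ext (@wlength R idfun).

(* Main.v *)
Require Import Defs.
From HB Require Import structures.
From mathcomp Require Import all_boot all_order all_algebra.
From mathcomp Require Import all_classical all_reals all_analysis.
From mathcomp Require Import -(notations) mpoly.
From mathcomp Require Import polyrcf.
From mathcomp Require Import zify ring lra.
Import Order.TTheory GRing.Theory Num.Theory.
Import numFieldNormedType.Exports.
Local Open Scope classical_set_scope.
Local Open Scope ring_scope.

(** Write [m = n - 1] and let [p_x] be the Taylor polynomial of order [m] of [f]
    at a critical point [x].

    If [p_x] is constant, the subdifferential gives
    [f y >= f x - C |y - x|^n]; exchanging [x] and [y] on a set where [C] is
    uniform yields [|f x - f y| <= C |x - y|^n].  Such a set has a null image:
    cut a cube of side [r] into [N^n] cells.  Either some cell misses the set,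
    and the trivial bound improves by the factor [1 - N^-n], or any two points
    are joined by a chain of [N] steps of length at most [3 r / N], and the
    image has length [O(N^(1-n) r^n)].

    Otherwise let [d^b p_x], of order [k < m], be a derivative vanishing at [x]
    with a nonzero partial derivative in the direction [j], all derivatives of
    order at most [k] being zero.  The set where this happens is a countable
    union of Lipschitz graphs over the hyperplane orthogonal to [e_j].
    Solving [d^b p_x = 0] for the coordinate [j] by Newton iteration, up to an
    error of order [m - k], and substituting the solution into [p_x] gives
    polynomials in one variable less which still approximate one another to
    order [m], because [p_x] is flat of order [k + 1] at [x].  As [f] has now
    order [m] on a set of dimension [m], an induction on the dimension
    concludes, with the same dichotomy at each step.

    Only jets indexed by the points of the set occur: no extension theorem and
    no implicit function is needed.  Throughout, [I] is the set of remaining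
    coordinates; the others are set to zero. *)

Set Implicit Arguments.
Unset Strict Implicit.
Unset Printing Implicit Defensive.

(** * Restriction of polynomials to lines *)

Section Restriction.
Variables (R : realType) (n : nat).
Implicit Types (p q : mpoly n R) (w a b : 'I_n -> R).

Definition restr_line a b p : {poly R} :=
  mmap (@polyC R) (fun i => (a i)%:P + (b i)%:P * 'X) p.

Lemma horner_restr_line a b p t :
  (restr_line a b p).[t] = meval (fun i => a i + b i * t) p.
Proof.
rewrite /restr_line mevalE /mmap horner_sum; apply: eq_bigr => m _.
rewrite /mmap1 hornerM hornerC horner_prod; congr (_ * _).
by apply: eq_bigr => i _; rewrite horner_exp !hornerE.
Qed.

Lemma size_restr_line a b p : (size (restr_line a b p) <= msize p)%N.
Proof.
rewrite /restr_line /mmap; apply: (leq_trans (size_sum _ _ _)).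
rewrite big_seq_cond; apply/bigmax_leqP_seq => m.
rewrite andbT => mp _.
have size_lin i : (size ((a i)%:P + (b i)%:P * 'X)%R <= 2)%N.
  apply: (leq_trans (size_polyD _ _)); rewrite geq_max.
  rewrite (leq_trans (size_polyC_leq1 _))//=.
  by rewrite (leq_trans (size_polyMleq _ _))// size_polyX addn2/= ltnS size_polyC_leq1.
have size_mmap1 : (size (mmap1 (fun i => ((a i)%:P + (b i)%:P * 'X)%R) m) <= (mdeg m).+1)%N.
  rewrite /mmap1 mdegE.
  elim/big_rec2: _ => [|i k r _ IH]; first by rewrite size_polyC oner_neq0.
  apply: (leq_trans (size_polyMleq _ _)).
  have : (size (((a i)%:P + (b i)%:P * 'X) ^+ m i)%R <= (m i).+1)%N.
    apply: (leq_trans (size_poly_exp_leq _ _)).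
    by rewrite ltnS -{2}(mul1n (m i)) leq_mul2r -subn1 leq_subLR addn1 size_lin orbT.
  move: IH; move: (size _) (size _) => s1 s2.
  by lia.
apply: leq_trans (msize_mdeg_lt mp).
apply: (leq_trans (size_polyMleq _ _)).
rewrite -subn1 leq_subLR; apply: leq_add; first exact: size_polyC_leq1.
exact: size_mmap1.
Qed.

(** Both sides are derivations along a ring morphism, so the chain rule passes to sums and products;
    only constants and variables are checked by hand. *)
Lemma deriv_restr_line a b p :
  (restr_line a b p)^`() = \sum_i (b i) *: restr_line a b (mderiv i p).
Proof.
pose L := restr_line a b.
have LD p1 p2 : L (p1 + p2) = L p1 + L p2 by exact: raddfD.
have LM p1 p2 : L (p1 * p2) = L p1 * L p2 by exact: rmorphM.
have LC c : L (mpolyC n c) = c%:P by exact: mmapC.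
have LX i : L (mpolyX R (mnm1 i)) = (a i)%:P + (b i)%:P * 'X.
  by rewrite /L /restr_line mmapX mmap1U.
pose P p := (L p)^`() = \sum_i (b i) *: L (mderiv i p).
have PD p1 p2 : P p1 -> P p2 -> P (p1 + p2).
  rewrite /P LD derivD => -> ->; rewrite -big_split/=; apply: eq_bigr => i _.
  by rewrite mderivD LD scalerDr.
have PM p1 p2 : P p1 -> P p2 -> P (p1 * p2).
  rewrite /P LM derivM => -> ->; rewrite mulr_suml mulr_sumr -big_split/=.
  apply: eq_bigr => i _.
  by rewrite mderivM LD !LM scalerDr -scalerAl -scalerAr.
have PC c : P (mpolyC n c).
  rewrite /P LC derivC big1// => i _.
  by rewrite mderivC -[0]/(mpolyC n 0) LC polyC0 scaler0.
have PX i : P (mpolyX R (mnm1 i)).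
  rewrite /P LX derivD derivC add0r derivM derivC mul0r add0r derivX mulr1.
  rewrite (bigD1 i)//= big1 => [|j ji].
    rewrite mderivX mnm1E eqxx.
    have -> : mnm_sub (mnm1 i) (mnm1 i) = mnm0 :> multinom n.
      by apply/mnmP => k; rewrite mnmBE mnm0E subnn.
    by rewrite scale1r mpolyX0 -[1]/(mpolyC n 1) LC addr0 alg_polyC.
  by rewrite mderivX mnm1E eq_sym (negbTE ji) scale0r -[0]/(mpolyC n 0) LC scaler0.
have PX' m : P (mpolyX R m).
  rewrite mpolyXE_id; apply: (big_ind P); [exact: (PC 1)|exact: PM|] => i _.
  elim: (m i) => [|k IH]; first by rewrite expr0; exact: (PC 1).
  by rewrite exprS; exact: PM.
rewrite -/(P p); elim/mpolyind: p => [|c m p _ _ IH]; first exact: (PC 0).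
by apply: PD => //; rewrite -mul_mpolyC; apply: PM.
Qed.

Lemma meval_mvt p a b : exists2 t, 0 <= t <= 1 &
  meval (fun i => a i + b i) p - meval a p =
  \sum_i b i * meval (fun i => a i + b i * t) (mderiv i p).
Proof.
have [t] := poly_mvt (restr_line a b p) (@ltr01 R).
rewrite in_itv/= => /andP[t0 t1] e; exists t; first by rewrite !ltW.
move: e; rewrite !horner_restr_line subr0 mulr1 deriv_restr_line horner_sum.
rewrite (meval_eq (v2 := fun i => a i + b i)) => [|i]; last by rewrite mulr1.
rewrite (meval_eq (v1 := fun i => a i + b i * 0) (v2 := a)) => [->|i].
  by apply: eq_bigr => i _; rewrite hornerZ horner_restr_line.
by rewrite mulr0 addr0.
Qed.

End Restriction.

(** A Markov type inequality: inverting a fixed Vandermonde matrix recovers the coefficients of the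
    rescaled polynomial from its values at [D + 2] nodes of [[0, 1]], so [C] depends on [D] only. *)
Lemma deriv0_bound (R : realType) (D : nat) : exists2 C : R, 0 <= C &
  forall (q : {poly R}) (r B : R), (size q <= D)%N -> 0 < r ->
    (forall t, 0 <= t <= r -> `|q.[t]| <= B) -> `|q^`().[0]| * r <= C * B.
Proof.
pose x : 'rV[R]_(D.+2) := \row_k (k%:R / D.+2%:R).
pose V := Vandermonde D.+2 x.
have uV : V \in unitmx.
  rewrite unitmxE det_Vandermonde unitfE; apply/prodf_neq0 => i _.
  apply/prodf_neq0 => j ij; rewrite !mxE -mulrBl mulf_neq0 ?invr_neq0 ?pnatr_eq0//.
  by rewrite subr_eq0 eqr_nat neq_ltn ij orbT.
exists (\sum_k `|invmx V k 1|); first by apply: sumr_ge0.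
move=> q r B qD r0 qB.
pose c : 'rV[R]_(D.+2) := \row_i (q`_i * r ^+ i).
have cV k : (c *m V) 0 k = q.[r * x 0 k].
  have sq : (size q <= D.+2)%N by rewrite (leq_trans qD)// ltnW.
  rewrite (horner_coef_wide _ sq).
  by rewrite mxE; apply: eq_bigr => i _; rewrite [c _ _]mxE [V _ _]mxE exprMn mulrA.
have -> : `|q^`().[0]| * r = `|c 0 1|.
  by rewrite -[in LHS](gtr0_norm r0) -normrM horner_coef0 coef_deriv mxE expr1.
rewrite -(mulmxK uV c) mxE mulr_suml.
apply: (le_trans (ler_norm_sum _ _ _)); apply: ler_sum => k _.
rewrite normrM mulrC ler_wpM2l// cV qB// mulr_ge0 ?(ltW r0) ?mxE ?divr_ge0//=.
by rewrite ler_piMr ?(ltW r0)// ler_pdivrMr// mul1r ler_nat ltnW.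
Qed.

(** * Mean value estimates and derivative bounds in several variables *)

Section PolynomialEstimates.
Variables (R : realType) (n : nat).
Implicit Types (p q G : mpoly n R) (w a y z : 'I_n -> R) (I : {set 'I_n}).

Definition sup_close (r : R) w y := forall i, `|w i - y i| <= r.
Definition supp I w := forall i, i \notin I -> w i = 0.
Definition upd w (j : 'I_n) (c : R) : 'I_n -> R :=
  fun i => if i == j then c else w i.
Definition dword (b : seq 'I_n) p := foldl (fun q i => mderiv i q) p b.

(** All orders are bounded at once, on a ball of fixed radius, so that the property passes to
    derivatives with the same [M]. *)
Definition bounded_jet (M : R) p y :=
  forall b w, sup_close 1 w y -> `|meval w (dword b p)| <= M.

Lemma sup_close_sym r w y : sup_close r w y -> sup_close r y w.
Proof. by move=> h i; rewrite distrC. Qed.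

Lemma sup_close_le r r' w y : r <= r' -> sup_close r w y -> sup_close r' w y.
Proof. by move=> rr h i; exact: le_trans (h i) rr. Qed.

Lemma sup_close_trans r r' y w z : sup_close r w y -> sup_close r' y z -> sup_close (r + r') w z.
Proof. by move=> h h' i; exact: le_trans (ler_distD _ _ _) (lerD (h i) (h' i)). Qed.

Lemma sup_close_refl r w : 0 <= r -> sup_close r w w.
Proof. by move=> r0 i; rewrite subrr normr0. Qed.

Lemma sup_close_upd r w y j c d : sup_close r w y -> `|c - d| <= r ->
  sup_close r (upd w j c) (upd y j d).
Proof. by move=> h h' i; rewrite /upd; case: eqP. Qed.

Lemma upd_id w j : upd w j (w j) = w.
Proof. by apply/funext => i; rewrite /upd; case: eqP => // ->. Qed.

Lemma upd_upd w j c d : upd (upd w j c) j d = upd w j d.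
Proof. by apply/funext => i; rewrite /upd; case: eqP. Qed.

Lemma supp_upd0 I w j : supp I w -> supp (I :\ j) (upd w j 0).
Proof.
by move=> h i; rewrite !inE negb_and negbK /upd; case: eqP => //= _; exact: h.
Qed.

Lemma supp_upd I w j c : j \in I -> supp (I :\ j) w -> supp I (upd w j c).
Proof.
move=> jI h i iI; rewrite /upd; case: eqP => [ij|/eqP ij].
  by move: iI; rewrite ij jI.
by apply: h; rewrite !inE negb_and iI orbT.
Qed.

Definition pt a w (t : R) : 'I_n -> R := fun i => a i + (w i - a i) * t.

Lemma sup_close_pt r a w y t : 0 <= t <= 1 -> sup_close r a y -> sup_close r w y ->
  sup_close r (pt a w t) y.
Proof.
move=> /andP[t0 t1] ha hw i; rewrite /pt.
have -> : a i + (w i - a i) * t - y i = (1 - t) * (a i - y i) + t * (w i - y i).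
  by ring.
apply: (le_trans (ler_normD _ _)).
rewrite !normrM (ger0_norm t0) ger0_norm ?subr_ge0//.
have -> : r = (1 - t) * r + t * r by ring.
by rewrite lerD// ler_wpM2l ?subr_ge0.
Qed.

Lemma supp_pt I a w t : supp I a -> supp I w -> supp I (pt a w t).
Proof. by move=> ha hw i iI; rewrite /pt ha// hw// subrr mul0r addr0. Qed.

Lemma meval_pt_mvt p a w : exists2 t, 0 <= t <= 1 &
  meval w p - meval a p = \sum_i (w i - a i) * meval (pt a w t) (mderiv i p).
Proof.
have [t t01 e] := meval_mvt p a (fun i => w i - a i); exists t => //.
by rewrite -e; congr (_ - _); apply: meval_eq => i; rewrite subrKC.
Qed.

Lemma meval_lipschitz I p a w r B : 0 <= r -> 0 <= B ->
  supp I a -> supp I w -> sup_close r w a ->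
  (forall i t, i \in I -> 0 <= t <= 1 ->
    `|meval (pt a w t) (mderiv i p)| <= B) ->
  `|meval w p - meval a p| <= n%:R * (r * B).
Proof.
move=> r0 B0 Ia Iw wa pB; have [t t01 ->] := meval_pt_mvt p a w.
apply: (le_trans (ler_norm_sum _ _ _)).
apply: (@le_trans _ _ (\sum_(i < n) r * B)); last first.
  by rewrite sumr_const card_ord mulr_natl.
apply: ler_sum => i _; rewrite normrM; have [iI|iI] := boolP (i \in I).
  by apply: ler_pM => //; exact: pB.
by rewrite Ia ?Iw// subrr normr0 mul0r mulr_ge0.
Qed.

Lemma meval_upd_mvt p w j c d : exists2 t, 0 <= t <= 1 &
  meval (upd w j d) p - meval (upd w j c) p =
  (d - c) * meval (upd w j (c + (d - c) * t)) (mderiv j p).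
Proof.
have [t t01 ->] := meval_pt_mvt p (upd w j c) (upd w j d); exists t => //.
rewrite (bigD1 j)//= big1 ?addr0 => [|i ij]; last first.
  by rewrite /upd (negbTE ij) subrr mul0r.
rewrite {1 2}/upd eqxx; congr (_ * _); apply: meval_eq => i.
by rewrite /pt /upd; case: eqP => // _; rewrite subrr mul0r addr0.
Qed.

Lemma between_close (c d u r t : R) : 0 <= t <= 1 -> `|c - u| <= r ->
  `|d - u| <= r -> `|c + (d - c) * t - u| <= r.
Proof.
move=> /andP[t0 t1] ha hw.
have -> : c + (d - c) * t - u = (1 - t) * (c - u) + t * (d - u) by ring.
apply: (le_trans (ler_normD _ _)).
rewrite !normrM (ger0_norm t0) ger0_norm ?subr_ge0//.
have -> : r = (1 - t) * r + t * r by ring.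
by rewrite lerD// ler_wpM2l ?subr_ge0.
Qed.

Lemma msize_mderiv i p : (msize (mderiv i p) <= (msize p).-1)%N.
Proof.
rewrite {1}msizeE; apply/bigmax_leqP_seq => m mp _.
move: mp; rewrite mcoeff_msupp mcoeff_deriv => h.
have /msize_mdeg_lt : mnm_add m (mnm1 i) \in msupp p.
  by rewrite mcoeff_msupp; apply: contra h => /eqP ->; rewrite mul0rn.
by rewrite mdegD mdeg1 addn1; case: (msize p).
Qed.

Lemma dword_cat b b' p : dword (b ++ b') p = dword b' (dword b p).
Proof. exact: foldl_cat. Qed.

Lemma bounded_jet_le M M' p y : M <= M' -> bounded_jet M p y -> bounded_jet M' p y.
Proof. by move=> h H b w /(H b)/le_trans; exact. Qed.

Lemma bounded_jet_dword M b p y : bounded_jet M p y -> bounded_jet M (dword b p) y.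
Proof. by move=> H b' w wy; rewrite -dword_cat; exact: H. Qed.

Lemma bounded_jet_mderiv M i p y : bounded_jet M p y -> bounded_jet M (mderiv i p) y.
Proof. exact: (@bounded_jet_dword M [:: i]). Qed.

Lemma bounded_jet0 M p y w : bounded_jet M p y -> sup_close 1 w y -> `|meval w p| <= M.
Proof. exact: (fun H => H [::] w). Qed.

Lemma meval_bounded p y : exists N : nat,
  forall w, sup_close 1 w y -> `|meval w p| <= N%:R.
Proof.
pose B := \sum_(m <- msupp p) `|mcoeff m p| * \prod_i (`|y i| + 1) ^+ m i.
have B0 : 0 <= B.
  by apply: sumr_ge0 => m _; rewrite mulr_ge0// prodr_ge0// => i _; rewrite exprn_ge0// addr_ge0.
exists (Num.Def.archi_bound B) => w wy.
apply: (@le_trans _ _ B); last by apply/ltW; have := archi_boundP B0.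
rewrite mevalE; apply: (le_trans (ler_norm_sum _ _ _)); apply: ler_sum => m _.
rewrite normrM ler_wpM2l// normr_prod; apply: ler_prod => i _.
rewrite normr_ge0/= normrX lerXn2r ?nnegrE ?addr_ge0//.
have -> : w i = y i + (w i - y i) by ring.
by rewrite (le_trans (ler_normD _ _))// lerD2l.
Qed.

(** Induction on the degree, which differentiation lowers. The bound is an integer because it will
    index a countable decomposition. *)
Lemma bounded_jet_ex p y : exists N : nat, bounded_jet N%:R p y.
Proof.
move: {2}(msize p) (leqnn (msize p)) => k.
elim: k p => [|k IH] p pk.
  exists 0 => b w _; move: pk; rewrite leqn0 msize_poly_eq0 => /eqP ->.
  have -> : dword b 0 = 0 by elim: b => // i b IHb; rewrite /dword/= mderiv0.
  by rewrite meval0 normr0.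
have [N0 hN0] := meval_bounded p y.
have /choice[N hN] (i : 'I_n) : exists N : nat, bounded_jet N%:R (mderiv i p) y.
  by apply: IH; rewrite (leq_trans (msize_mderiv _ _))// -subn1 leq_subLR.
exists (maxn N0 (\max_i N i)) => -[|i b] w wy.
  by rewrite (le_trans (hN0 _ wy))// ler_nat leq_maxl.
rewrite (le_trans (hN i b _ wy))// ler_nat (leq_trans _ (leq_maxr _ _))//.
exact: leq_bigmax.
Qed.

End PolynomialEstimates.

(** * Jets *)

Section Jets.
Variables (R : realType) (n : nat).
Implicit Types (p q G : mpoly n R) (w a y z : 'I_n -> R) (I : {set 'I_n}).

Definition flat_to I k y p :=
  forall b, all (fun i => i \in I) b -> (size b < k)%N -> meval y (dword b p) = 0.

(** Concerns orders 1 to [k] along [I]; the value at [y] is left free, since it is the critical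
    value. *)
Definition stationary I k y p := forall i, i \in I -> flat_to I k y (mderiv i p).

(** Each mean value step passes to first derivatives and gains a factor [n%:R * r]; after [k] steps,
    [M] bounds what remains. *)
Lemma flat_bound I p y M k w r : 0 <= M -> 0 <= r <= 1 -> supp I y -> supp I w ->
  sup_close r w y -> bounded_jet M p y -> flat_to I k y p ->
  `|meval w p| <= (n%:R * r) ^+ k * M.
Proof.
move=> M0 /andP[r0 r1] Iy; elim: k p w => [|k IH] p w Iw wy Mp pk.
  by rewrite expr0 mul1r; apply: bounded_jet0 Mp _; exact: sup_close_le wy.
have py : meval y p = 0 by exact: (pk [::]).
rewrite -[meval w p]subr0 -py exprS -!mulrA.
rewrite (le_trans (meval_lipschitz (I := I) (r := r) (B := (n%:R * r) ^+ k * M) _ _ _ _ _ _))//.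
  by rewrite mulr_ge0// exprn_ge0// mulr_ge0.
move=> i t iI t01; apply: IH.
- exact: supp_pt.
- by apply: sup_close_pt => //; exact: sup_close_refl.
- exact: bounded_jet_mderiv.
- by move=> b bI bk; apply: (pk (i :: b)) => //=; rewrite iI.
Qed.

Lemma stationary_bound I p y M k w r : 0 <= M -> 0 <= r <= 1 -> supp I y ->
  supp I w -> sup_close r w y -> bounded_jet M p y -> stationary I k y p ->
  `|meval w p - meval y p| <= n%:R * (r * ((n%:R * r) ^+ k * M)).
Proof.
move=> M0 r01 Iy Iw wy Mp pk; have /andP[r0 r1] := r01.
apply: (meval_lipschitz (I := I)) => // [|i t iI t01].
  by rewrite mulr_ge0// exprn_ge0// mulr_ge0.
apply: (flat_bound (I := I) (y := y)) => //.
- exact: supp_pt.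
- by apply: sup_close_pt => //; exact: sup_close_refl.
- exact: bounded_jet_mderiv.
- exact: pk.
Qed.

(** Take a shortest nonempty word in [I] along which the derivative does not vanish. It has length
    at least 2 by [stationary I 1]; [j] is its last letter and [b] the rest. *)
Lemma first_jet I s y p : stationary I 1 y p -> ~ stationary I s y p ->
  exists (b : seq 'I_n) j, [/\ all (fun i => i \in I) b && (j \in I), (0 < size b < s)%N,
    stationary I (size b) y p, meval y (dword b p) = 0 &
    meval y (mderiv j (dword b p)) != 0].
Proof.
move=> st1; elim: s => [|s IH] nst; first by exfalso; apply: nst => i _ b.
have [st|{}/IH] := pselect (stationary I s y p); last first.
  by move=> [b [j [? /andP[b0 bs] ? ? ?]]]; exists b, j; split => //; rewrite b0 ltnW.
have s0 : (0 < s)%N by case: s nst {IH st} => // /(_ st1).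
have [i [iI [b [bI bs pb]]]] : exists i, i \in I /\ exists b, [/\
    all (fun i => i \in I) b, (size b < s.+1)%N & meval y (dword b (mderiv i p)) != 0].
  apply: contrapT => h; apply: nst => i iI b bI bs; apply/eqP; apply: contrapT => pb.
  by apply: h; exists i; split => //; exists b; split => //; apply/negP.
have sb : size b = s.
  apply/eqP; rewrite eqn_leq -ltnS bs/= leqNgt; apply/negP => bs'.
  by move: pb; rewrite (st i iI b bI bs') eqxx.
case/lastP: b bI bs pb sb => [_ _ _ /esym s0'|b j bI _ pb sb].
  by rewrite s0' in s0.
move: bI; rewrite all_rcons => /andP[jI bI]; rewrite size_rcons in sb.
exists (i :: b), j; rewrite /= iI bI jI sb ltnSn; split => //.
  by apply: (st i iI) => //; rewrite -sb.
by move: pb; rewrite /dword/= foldl_rcons.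
Qed.

Variable X : Type.
Implicit Types (A : set X) (c : X -> 'I_n -> R) (P : X -> mpoly n R).

(* Whitney's compatibility condition for jets of order [s], stated through the
   values of the polynomials rather than through their coefficients. *)
Definition compat A c I P s (K d : R) := forall x x', A x -> A x' ->
  forall w r, supp I w -> 0 < r <= d -> sup_close r w (c x) -> sup_close r w (c x') ->
  `|meval w (P x) - meval w (P x')| <= K * r ^+ s.

(** [deriv0_bound] is applied to [P x - P x'] on the segment of length [r] from [w] in the direction
    [i]. This segment stays within [2 * r] of both centres, hence [2 ^+ s.+1] and [d / 2]; dividing
    by [r] costs one order. *)
Lemma compat_mderiv D s : exists2 C : R, 0 <= C &
  forall A c I P K d i, i \in I -> 0 <= K -> (forall x, A x -> (msize (P x) <= D)%N) ->
    compat A c I P s.+1 K d -> compat A c I (fun x => mderiv i (P x)) s (C * K) (d / 2).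
Proof.
have [C C0 hC] := deriv0_bound R D; exists (C * 2 ^+ s.+1).
  by rewrite mulr_ge0.
move=> A c I P K d i iI K0 PD cP x x' Ax Ax' w r Iw /andP[r0 rd] wx wx'.
pose q := P x - P x'; pose e k : R := (k == i)%:R.
have -> : meval w (mderiv i (P x)) - meval w (mderiv i (P x')) =
    (restr_line w e q)^`().[0].
  rewrite deriv_restr_line horner_sum (bigD1 i)//= big1 => [|k ki].
    rewrite hornerZ horner_restr_line /e eqxx mul1r addr0 mderivB mevalB.
    by congr (_ - _); apply: meval_eq => k; rewrite mulr0 addr0.
  by rewrite hornerZ /e (negbTE ki) mul0r.
rewrite -(ler_pM2r r0).
have -> : C * 2 ^+ s.+1 * K * r ^+ s * r = C * (K * (2 * r) ^+ s.+1).
  by rewrite exprMn (exprSr r); ring.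
apply: hC => // [|t /andP[t0 tr]].
  apply: (leq_trans (size_restr_line _ _ _)).
  apply: (leq_trans (msizeD_le _ _)); rewrite geq_max PD//=.
  by rewrite msizeN PD.
rewrite horner_restr_line mevalB; apply: cP => //.
- move=> k kI; rewrite Iw// /e; case: eqP => [ki|_]; last by rewrite mul0r addr0.
  by move: kI; rewrite ki iI.
- by rewrite mulr_gt0//= mulrC -ler_pdivlMr.
- move=> k; have := wx k; rewrite /e => h.
  have -> : w k + (k == i)%:R * t - c x k = (w k - c x k) + (k == i)%:R * t by ring.
  have -> : 2 * r = r + r by ring.
  rewrite (le_trans (ler_normD _ _))// lerD//.
  by case: eqP => _; rewrite ?mul1r ?mul0r ?normr0 ?ger0_norm// ltW.
- move=> k; have := wx' k; rewrite /e => h.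
  have -> : w k + (k == i)%:R * t - c x' k = (w k - c x' k) + (k == i)%:R * t by ring.
  have -> : 2 * r = r + r by ring.
  rewrite (le_trans (ler_normD _ _))// lerD//.
  by case: eqP => _; rewrite ?mul1r ?mul0r ?normr0 ?ger0_norm// ltW.
Qed.

Lemma compat_dword D s k : exists2 C : R, 0 <= C &
  forall A c I P K d b, all (fun i => i \in I) b -> size b = k -> 0 <= K ->
    (forall x, A x -> (msize (P x) <= D)%N) ->
    compat A c I P (s + k) K d ->
    compat A c I (fun x => dword b (P x)) s (C * K) (d / 2 ^+ k).
Proof.
elim: k => [|k [C C0 IH]].
  exists 1 => // A c I P K d [|//] _ _ K0 _.
  by rewrite addn0 expr0 divr1 mul1r.
have [C' C'0 hC'] := compat_mderiv D (s + k).
exists (C * C'); first by rewrite mulr_ge0.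
move=> A c I P K d [//|i b] /= /andP[iI bI] [bk] K0 PD cP.
rewrite -mulrA exprS invfM (mulrA d).
apply: (IH A c I (fun x => mderiv i (P x))) => //; first by rewrite mulr_ge0.
  move=> x Ax; rewrite (leq_trans (msize_mderiv _ _))// -subn1 leq_subLR.
  by rewrite (leq_trans (PD _ Ax)).
by apply: hC' => //; rewrite -addnS.
Qed.

End Jets.

(** * Newton iteration *)

Section Newton.
Variables (R : realType) (n : nat).
Implicit Types (p q G : mpoly n R) (w a y z : 'I_n -> R) (I : {set 'I_n}).

Lemma suppT w : supp [set: 'I_n]%SET w.
Proof. by move=> i; rewrite inE. Qed.

(** By [deriv0_bound], applied to the restriction to a line minus its value at 0, the derivative is
    at most a fixed multiple of the arbitrary [e]. *)
Lemma mderiv_eq0 i p y :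
  (forall e, 0 < e -> exists2 d, 0 < d & forall t, 0 < t <= d ->
    `|meval (fun k => y k + (k == i)%:R * t) p - meval y p| <= e * t) ->
  meval y (mderiv i p) = 0.
Proof.
move=> h; pose L := restr_line y (fun k => (k == i)%:R) p.
have [C C0 hC] := deriv0_bound R (size (L - (L.[0])%:P)).
have L0 : L.[0] = meval y p.
  by rewrite horner_restr_line; apply: meval_eq => k; rewrite mulr0 addr0.
have dL : meval y (mderiv i p) = (L - (L.[0])%:P)^`().[0].
  rewrite derivB derivC subr0 deriv_restr_line horner_sum (bigD1 i)//= big1 => [|k ki].
    rewrite hornerZ horner_restr_line eqxx mul1r addr0.
    by apply: meval_eq => k; rewrite mulr0 addr0.
  by rewrite hornerZ (negbTE ki) mul0r.
apply/eqP; rewrite -normr_le0; apply/ler_addgt0Pr => e e0; rewrite add0r.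
have C1 : 0 < C + 1 by rewrite ltr_wpDl.
have [d d0 hd] := h (e / (C + 1)) (divr_gt0 e0 C1).
rewrite -(ler_pM2r d0) dL.
apply: (le_trans (hC (L - (L.[0])%:P) d (e / (C + 1) * d) (leqnn _) d0 _)).
  move=> t /andP[t0 td]; rewrite !hornerE -/L L0; have [->|tn0] := eqVneq t 0.
    by rewrite L0 subrr normr0 mulr_ge0 ?divr_ge0 ?ltW.
  have tp : 0 < t by rewrite lt_neqAle eq_sym tn0.
  rewrite /L horner_restr_line (le_trans (hd t _)) ?tp//.
  by rewrite ler_wpM2l// divr_ge0 ?ltW.
rewrite mulrA ler_wpM2r ?(ltW d0)// mulrA ler_pdivrMr// mulrC ler_wpM2l ?(ltW e0)//.
by rewrite lerDl.
Qed.

Definition subst_var (j : 'I_n) (Phi p : mpoly n R) : mpoly n R :=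
  comp_mpoly [tuple if i == j then Phi else mpolyX R (mnm1 i) | i < n] p.

Lemma meval_subst_var j Phi p w :
  meval w (subst_var j Phi p) = meval (upd w j (meval w Phi)) p.
Proof.
rewrite comp_mpoly_meval; apply: meval_eq => i.
by rewrite tnth_mktuple /upd; case: eqP => // _; rewrite mevalXU.
Qed.

(* Newton iterates, with frozen slope [a], for the equation [G = 0] solved for
   the variable [j]. *)
Fixpoint newton G (j : 'I_n) (a y0 : R) (i : nat) : mpoly n R :=
  if i is k.+1 then
    newton G j a y0 k - a^-1 *: subst_var j (newton G j a y0 k) G
  else mpolyC n y0.

(* Each iteration raises the order of vanishing of [G] by one. *)
Lemma newton_bound (M c0 : R) i : 0 <= M -> 0 < c0 -> exists C d : R,
  [/\ 0 <= C, 0 < d <= 1 & forall G y j, bounded_jet M G y -> meval y G = 0 ->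
    c0 <= `|meval y (mderiv j G)| ->
    forall w r, 0 <= r <= d -> sup_close r (upd w j (y j)) y ->
    let phi := meval w (newton G j (meval y (mderiv j G)) (y j) i) in
    `|phi - y j| <= C * r /\ `|meval (upd w j phi) G| <= C * r ^+ i.+1].
Proof.
move=> M0 c00; elim: i => [|i [C [d [C0 /andP[d0 d1] IH]]]].
  exists (n%:R * M), 1; split; rewrite ?mulr_ge0 ?ltr01 ?lexx//.
  move=> G y j MG Gy _ w r /andP[r0 r1] wy /=; rewrite mevalC subrr normr0.
  split; first by rewrite !mulr_ge0.
  rewrite -[meval _ G]subr0 -Gy -mulrA (mulrC M) expr1.
  apply: (meval_lipschitz (I := [set: 'I_n]%SET)) => // [||k t _ t01]; try exact: suppT.
  apply: (bounded_jet0 (bounded_jet_mderiv k MG)); apply: sup_close_pt => //.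
    exact: sup_close_refl.
  exact: sup_close_le wy.
(* [C1 * r] bounds the distance of the new iterate to [y j]: that of the old one plus the correction
   [g / a]. As [C2] is at least 1, [C2 * r] bounds the other coordinates too. *)
pose C1 := C + C / c0; pose C2 := C1 + 1.
have C10 : 0 <= C1 by rewrite addr_ge0// divr_ge0// ltW.
have C20 : 0 < C2 by rewrite ltr_wpDl.
exists (C1 + C / c0 * (n%:R * (C2 * M))), (d / C2); split.
- rewrite addr_ge0// !mulr_ge0 ?invr_ge0//; exact: ltW.
- by rewrite divr_gt0//= ler_pdivrMr// mul1r (le_trans d1)// lerDr.
move=> G y j MG Gy; set a := meval y _ => ca w r /andP[r0 rd] wy phi'.
have C2r : C2 * r <= d by rewrite mulrC -ler_pdivlMr.
have rd' : r <= d by rewrite (le_trans _ C2r)// ler_peMl// lerDr.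
have [] := IH G y j MG Gy ca w r _ wy; first by rewrite r0.
rewrite -/a; set phi := meval w _ => phi1; set g := meval _ G => g1.
have r1 : r <= 1 by rewrite (le_trans rd').
have phi'E : phi' = phi - a^-1 * g by rewrite /phi' /= mevalB mevalZ meval_subst_var.
have a0 : a != 0 by rewrite -normr_gt0 (lt_le_trans c00).
have ag : `|a^-1 * g| <= C / c0 * r ^+ i.+1.
  rewrite normrM normfV mulrC mulrAC ler_pM ?invr_ge0//.
  by rewrite lef_pV2 ?posrE// (lt_le_trans c00).
have ag' : `|a^-1 * g| <= C / c0 * r.
  rewrite (le_trans ag)// ler_wpM2l ?divr_ge0 ?(ltW c00)//.
  by rewrite exprS ler_piMr// exprn_ile1.
have C1r : `|phi' - y j| <= C1 * r.
  rewrite phi'E addrAC (le_trans (ler_normB _ _))// /C1 mulrDl lerD//.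
split.
  by rewrite (le_trans C1r)// ler_wpM2r// lerDl !mulr_ge0 ?invr_ge0// ltW.
have [t t01 Gt] := meval_upd_mvt G w j phi phi'.
set xi := phi + _ in Gt.
have xiy : sup_close (C2 * r) (upd w j xi) y.
  rewrite -(upd_upd w j (y j)) -[X in sup_close _ _ X](upd_id y j).
  apply: sup_close_upd.
    by apply: sup_close_le wy; rewrite ler_peMl// lerDr.
  have C12 : C1 * r <= C2 * r by rewrite ler_wpM2r// lerDl.
  apply: between_close => //; last exact: le_trans C1r C12.
  by rewrite (le_trans phi1)// (le_trans _ C12)// ler_wpM2r// lerDl divr_ge0// ltW.
have dG : `|meval (upd w j xi) (mderiv j G) - a| <= n%:R * (C2 * r * M).
  apply: (meval_lipschitz (I := [set: 'I_n]%SET)) => //; try exact: suppT.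
    by rewrite mulr_ge0// ltW.
  move=> k s _ s01; apply: (bounded_jet0 (bounded_jet_mderiv k (bounded_jet_mderiv j MG))).
  apply: sup_close_pt => //; first exact: sup_close_refl.
  exact: sup_close_le (le_trans C2r d1) xiy.
(* The correction by [g / a] cancels the main term: what remains is [g / a] times the variation of
   the derivative, which is [O(r)]. This is the gained order. *)
have -> : meval (upd w j phi') G = - (a^-1 * g) * (meval (upd w j xi) (mderiv j G) - a).
  move/eqP: Gt; rewrite subr_eq => /eqP ->; rewrite -/g phi'E.
  by field.
rewrite normrM normrN.
apply: (le_trans (ler_pM _ _ ag dG)) => //.
rewrite [leRHS]mulrDl ler_wpDl//; first by rewrite mulr_ge0// exprn_ge0.
by rewrite le_eqVlt (exprSr r i.+1); apply/orP; left; apply/eqP; ring.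
Qed.

Variable X : Type.
Implicit Types (A : set X) (c : X -> 'I_n -> R) (P : X -> mpoly n R).

(** Go from [c x] to [v] without moving the coordinate [j], then to [c x'] along [j]. In absolute
    value [P x] is [O(r)] at [v] and at most [c0 / 4 * (r + D)] at [c x'], while its slope along [j]
    is at least [c0 / 2]; so the term in [D], the distance along [j], is absorbed. *)
Lemma zero_set_lipschitz A c I P j (M c0 eta : R) : j \in I -> 0 <= M -> 0 < c0 ->
  0 < eta <= 1 -> n%:R * (eta * M) <= c0 / 2 ->
  (forall x, A x -> [/\ supp I (c x), bounded_jet M (P x) (c x),
     meval (c x) (P x) = 0 & c0 <= `|meval (c x) (mderiv j (P x))|]) ->
  (forall x x', A x -> A x' -> sup_close eta (c x) (c x')) ->
  (forall x x' r, A x -> A x' -> 0 < r -> sup_close r (c x) (c x') ->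
    `|meval (c x') (P x)| <= c0 / 4 * r) ->
  forall x x' r, A x -> A x' -> 0 <= r ->
    sup_close r (upd (c x) j 0) (upd (c x') j 0) ->
    `|c x j - c x' j| <= (1 + 4 * n%:R * M / c0) * r.
Proof.
move=> jI M0 c00 /andP[eta0 eta1] Meta hA small PA x x' r Ax Ax' r0 xx'.
have [Ix MP Px cP] := hA _ Ax; have [Ix' _ _ _] := hA _ Ax'.
pose v := upd (c x') j (c x j).
have vx : sup_close eta v (c x).
  rewrite -[X in sup_close _ _ X](upd_id (c x) j); apply: sup_close_upd.
    exact: small.
  by rewrite subrr normr0 ltW.
have vxr : sup_close r v (c x).
  rewrite -[X in sup_close _ _ X](upd_id (c x) j) /v.
  rewrite -(upd_upd _ _ 0) -(upd_upd (c x) j 0); apply: sup_close_upd.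
    exact: sup_close_sym.
  by rewrite subrr normr0.
have Iv : supp I v by move=> i iI; rewrite /v /upd; case: eqP => [ij|_];
  [exfalso; move: iI; rewrite ij jI|exact: Ix'].
have [t t01 Pt] := meval_upd_mvt (P x) (c x') j (c x j) (c x' j).
rewrite upd_id in Pt; set xi := c x j + _ in Pt.
have xix : sup_close eta (upd (c x') j xi) (c x).
  rewrite -[X in sup_close _ _ X](upd_id (c x) j); apply: sup_close_upd.
    exact: small.
  apply: between_close => //; last exact: (small _ _ Ax' Ax j).
  by rewrite subrr normr0 ltW.
have dP : `|meval (upd (c x') j xi) (mderiv j (P x)) - meval (c x) (mderiv j (P x))|
    <= c0 / 2.
  apply: (le_trans _ Meta).
  apply: (meval_lipschitz (I := [set: 'I_n]%SET)) => //; rewrite ?(ltW eta0)//; try exact: suppT.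
  move=> k s _ s01; apply: (bounded_jet0 (bounded_jet_mderiv k (bounded_jet_mderiv j MP))).
  apply: sup_close_pt => //; first exact: sup_close_refl.
  exact: sup_close_le xix.
have dPge : c0 / 2 <= `|meval (upd (c x') j xi) (mderiv j (P x))|.
  have := ler_distD (meval (upd (c x') j xi) (mderiv j (P x))) (meval (c x) (mderiv j (P x))) 0.
  rewrite !subr0 distrC; lra.
have vP : `|meval v (P x)| <= n%:R * (r * M).
  rewrite -[meval v _]subr0 -Px.
  apply: (meval_lipschitz (I := [set: 'I_n]%SET)) => //; try exact: suppT.
  move=> k s _ s01; apply: (bounded_jet0 (bounded_jet_mderiv k MP)).
  apply: sup_close_pt => //; first exact: sup_close_refl.
  exact: sup_close_le vx.
set D := `|c x j - c x' j|.
have D0 : 0 <= D by exact: normr_ge0.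
have [rD0|rD0] := eqVneq (r + D) 0.
  have -> : D = 0 by lra.
  by rewrite mulr_ge0// addr_ge0// divr_ge0 ?mulr_ge0// ltW.
have rD : 0 < r + D by rewrite lt_neqAle eq_sym rD0 addr_ge0.
have xxD : sup_close (r + D) (c x) (c x').
  rewrite -(upd_id (c x) j) -(upd_id (c x') j) -(upd_upd _ _ 0) -(upd_upd (c x') j 0).
  apply: sup_close_upd; last by rewrite lerDr.
  by apply: sup_close_le xx'; rewrite lerDl.
have Px' := PA _ _ _ Ax Ax' rD xxD.
have key : D * (c0 / 2) <= c0 / 4 * (r + D) + n%:R * (r * M).
  apply: (@le_trans _ _ `|meval (c x') (P x) - meval v (P x)|).
    by rewrite Pt normrM distrC ler_wpM2l.
  by rewrite (le_trans (ler_normB _ _))// lerD.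
have -> : (1 + 4 * n%:R * M / c0) * r = (c0 / 4 * r + n%:R * (r * M)) / (c0 / 4).
  by field; rewrite gt_eqF.
rewrite ler_pdivlMr ?divr_gt0//; lra.
Qed.

End Newton.

(** * Elimination of a variable *)

Section Elimination.
Variables (R : realType) (n : nat) (X : Type).
Implicit Types (A : set X) (c : X -> 'I_n -> R) (I : {set 'I_n}).
Implicit Types (P : X -> mpoly n R) (w y z : 'I_n -> R).

(** [P' x] replaces the coordinate [j] by the result of [q] Newton steps on [G x]. Two such results
    differ by [O(r ^+ q.+1)], and the derivative of [P x'] along [j] is [O(r ^+ size b)], so the
    substitution loses no order. *)
Lemma eliminate_variable A c I P b j (M c0 L K d : R) D q :
  0 <= M -> 0 < c0 -> 0 <= L -> 0 <= K -> 0 < d ->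
  all (fun i => i \in I) b -> j \in I -> (0 < size b)%N ->
  (forall x, A x -> [/\ supp I (c x), (msize (P x) <= D)%N,
     bounded_jet M (P x) (c x), stationary I (size b) (c x) (P x) &
     meval (c x) (dword b (P x)) = 0 /\
     c0 <= `|meval (c x) (mderiv j (dword b (P x)))|]) ->
  compat A c I P (q.+1 + size b) K d ->
  (forall x x' r, A x -> A x' -> 0 <= r ->
    sup_close r (upd (c x) j 0) (upd (c x') j 0) -> `|c x j - c x' j| <= L * r) ->
  exists (P' : X -> mpoly n R) (K' d' : R),
    [/\ 0 <= K', 0 < d',
     compat A (fun x => upd (c x) j 0) (I :\ j) P' (q.+1 + size b) K' d' &
     forall x, A x -> meval (upd (c x) j 0) (P' x) = meval (c x) (P x) /\
       stationary (I :\ j) 1 (upd (c x) j 0) (P' x)].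
Proof.
move=> M0 c00 L0 K0 d0 bI jI b0 hA cP lipA.
have [C1 [d1 [C10 /andP[d10 d11] hN]]] := newton_bound n q M0 c00.
have [C2 C20 hD] := @compat_dword R n X D q.+1 (size b).
pose G x := dword b (P x).
have cG : compat A c I G q.+1 (C2 * K) (d / 2 ^+ size b).
  by apply: hD => // x /hA[].
pose Phi x := newton (G x) j (meval (c x) (mderiv j (G x))) (c x j) q.
pose P' x := subst_var j (Phi x) (P x).
have MG x : A x -> bounded_jet M (G x) (c x).
  by move=> /hA[_ _ MP _ _]; exact: bounded_jet_dword.
(* The substituted points will lie within [E * r] of both [c x] and [c x']: [C1] pays for the Newton
   iterates and [2 * L] for the gap between [c x j] and [c x' j]. *)
pose E := 1 + C1 + 2 * L.
have E1 : 1 <= E by rewrite /E -addrA lerDl addr_ge0// mulr_ge0.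
have E0 : 0 < E by exact: lt_le_trans E1.
have PhiP x w r : A x -> 0 <= r <= d1 -> sup_close r w (upd (c x) j 0) ->
    `|meval w (Phi x) - c x j| <= C1 * r /\
    `|meval (upd w j (meval w (Phi x))) (G x)| <= C1 * r ^+ q.+1.
  move=> Ax rd wx; have [_ _ _ _ [Gx cGx]] := hA _ Ax.
  apply: hN => //; first exact: MG.
  rewrite -[X in sup_close _ _ X](upd_id (c x) j) -[X in sup_close _ _ X](upd_upd _ _ 0).
  apply: sup_close_upd => //; rewrite subrr normr0.
  by case/andP: rd.
have Phi0 x : A x -> meval (upd (c x) j 0) (Phi x) = c x j.
  move=> Ax; have [] := PhiP x (upd (c x) j 0) 0 Ax.
  - by rewrite lexx ltW.
  - exact: sup_close_refl.
  by rewrite mulr0 normr_le0 subr_eq0 => /eqP.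
have PhiE x w r : A x -> 0 <= r <= d1 -> sup_close r w (upd (c x) j 0) ->
    sup_close (E * r) (upd w j (meval w (Phi x))) (c x).
  move=> Ax /andP[r0 rd] wx; have [|h _] := PhiP x w r Ax _ wx; first by rewrite r0.
  rewrite -[X in sup_close _ _ X](upd_id (c x) j) -[X in sup_close _ _ X](upd_upd _ _ 0).
  apply: sup_close_upd.
    by apply: sup_close_le wx; rewrite ler_peMl.
  by rewrite (le_trans h)// ler_wpM2r// /E addrAC lerDr addr_ge0// mulr_ge0.
exists P'.
(* In order: the radius for [cP], for [cG], for the bounded jets, and for keeping the slope along
   [j] above [c0 / 2]. *)
pose b1 := Num.min (Num.min d (d / 2 ^+ size b)) (Num.min 1 (c0 / 2 / (n%:R * M + 1))).
have nM0 : 0 < n%:R * M + 1 by rewrite ltr_wpDl// mulr_ge0.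
have b10 : 0 < b1 by rewrite /b1 !lt_min d0 ltr01 !divr_gt0// exprn_gt0.
pose d' := Num.min d1 (b1 / E).
pose C3 := (C2 * K * E ^+ q.+1 + 2 * C1) / (c0 / 2).
have C30 : 0 <= C3.
  by rewrite divr_ge0 ?divr_ge0 ?(ltW c00)// addr_ge0 ?mulr_ge0// exprn_ge0// ltW.
exists (K * E ^+ (q.+1 + size b) + C3 * ((n%:R * E) ^+ size b * M)), d'.
split.
- have E0w := ltW E0; apply: addr_ge0; apply: mulr_ge0 => //; first exact: exprn_ge0.
  by apply: mulr_ge0 => //; apply: exprn_ge0; exact: mulr_ge0.
- by rewrite /d' lt_min d10 divr_gt0.
- move=> x x' Ax Ax' w r Iw /andP[r0 rd'] wx wx'.
  have [rd1 rE] : r <= d1 /\ E * r <= b1.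
    by move: rd'; rewrite /d' le_min ler_pdivlMr// mulrC => /andP[].
  move: rE; rewrite /b1 !le_min => /andP[/andP[rEd rEd2] /andP[rE1 rEc]].
  have r0' := ltW r0.
  have rd1' : 0 <= r <= d1 by rewrite r0'.
  have Er0 : 0 < E * r by rewrite mulr_gt0.
  set u := upd w j (meval w (Phi x)); set v := upd w j (meval w (Phi x')).
  have [Ix _ MP _ _] := hA _ Ax; have [Ix' _ MP' st' [_ cG']] := hA _ Ax'.
  have ux : sup_close (E * r) u (c x) by exact: PhiE.
  have vx' : sup_close (E * r) v (c x') by exact: PhiE.
  have [phi1 G1] := PhiP x w r Ax rd1' wx.
  have [phi2 G2] := PhiP x' w r Ax' rd1' wx'.
  have xx' : `|c x j - c x' j| <= L * (2 * r).
    apply: lipA => //; first by rewrite mulr_ge0.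
    have -> : 2 * r = r + r by ring.
    by apply: sup_close_trans wx'; exact: sup_close_sym.
  have phi12 : `|meval w (Phi x) - c x' j| <= E * r.
    rewrite (le_trans (ler_distD (c x j) _ _))// (le_trans (lerD phi1 xx'))//.
    by rewrite /E; nra.
  have phi22 : `|meval w (Phi x') - c x' j| <= E * r.
    by have := vx' j; rewrite /v /upd eqxx.
  have ux' : sup_close (E * r) u (c x').
    rewrite -[X in sup_close _ _ X](upd_id (c x') j) -[X in sup_close _ _ X](upd_upd _ _ 0).
    by apply: sup_close_upd => //; apply: sup_close_le wx'; rewrite ler_peMl.
  have Iu : supp I u by exact: supp_upd.
  have GG : `|meval u (G x) - meval u (G x')| <= C2 * K * (E * r) ^+ q.+1.
    by apply: cG => //; rewrite Er0.
  have PP : `|meval u (P x) - meval u (P x')| <= K * (E * r) ^+ (q.+1 + size b).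
    by apply: cP => //; rewrite Er0.
  (* Both Newton results nearly annihilate [G x'], that of [x] because [G x] is close to [G x']. The
     lower bound [c0 / 2] of the slope makes them close to each other. *)
  have step1 : `|meval w (Phi x) - meval w (Phi x')| * (c0 / 2) <=
      (C2 * K * E ^+ q.+1 + 2 * C1) * r ^+ q.+1.
    have [t t01 Gt] := meval_upd_mvt (G x') w j (meval w (Phi x')) (meval w (Phi x)).
    pose xi := upd w j (meval w (Phi x') + (meval w (Phi x) - meval w (Phi x')) * t).
    have xix : sup_close (E * r) xi (c x').
      rewrite -[X in sup_close _ _ X](upd_id (c x') j) -[X in sup_close _ _ X](upd_upd _ _ 0).
      apply: sup_close_upd; first by apply: sup_close_le wx'; rewrite ler_peMl.
      exact: between_close.
    have dG : `|meval xi (mderiv j (G x')) - meval (c x') (mderiv j (G x'))| <= c0 / 2.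
      have : `|meval xi (mderiv j (G x')) - meval (c x') (mderiv j (G x'))|
         <= n%:R * (E * r * M).
        apply: (meval_lipschitz (I := [set: 'I_n]%SET)) => //; rewrite ?(ltW Er0)//;
          try exact: suppT.
        move=> k s _ s01.
        apply: (bounded_jet0 (bounded_jet_mderiv k (bounded_jet_mderiv j (MG _ Ax')))).
        apply: sup_close_pt => //; first exact: sup_close_refl.
        exact: sup_close_le xix.
      move=> /le_trans; apply; move: rEc; rewrite ler_pdivlMr// => h.
      by rewrite (le_trans _ h)// mulrCA ler_wpM2l ?(ltW Er0)// lerDl.
    have dGge : c0 / 2 <= `|meval xi (mderiv j (G x'))|.
      have := ler_distD (meval xi (mderiv j (G x'))) (meval (c x') (mderiv j (G x'))) 0.
      rewrite !subr0 distrC; move: cG'; rewrite -/(G x'); lra.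
    have : `|meval u (G x') - meval v (G x')| <= (C2 * K * E ^+ q.+1 + 2 * C1) * r ^+ q.+1.
      have -> : (C2 * K * E ^+ q.+1 + 2 * C1) * r ^+ q.+1 =
          (C2 * K * (E * r) ^+ q.+1 + C1 * r ^+ q.+1) + C1 * r ^+ q.+1.
        by rewrite exprMn; ring.
      apply: (le_trans (ler_normB _ _)); apply: lerD => //.
      rewrite -[meval u (G x')](subKr (meval u (G x))).
      by apply: (le_trans (ler_normB _ _)); rewrite addrC; exact: lerD.
    apply: le_trans; rewrite Gt normrM ler_wpM2l//.
  have step2 : `|meval w (Phi x) - meval w (Phi x')| <= C3 * r ^+ q.+1.
    by rewrite /C3 mulrAC ler_pdivlMr// divr_gt0.
  (* The flatness of [P x'] at [c x'] restores the [size b] orders lost in passing from [P] to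
     [G]. *)
  have step3 : `|meval u (P x') - meval v (P x')| <=
      C3 * r ^+ q.+1 * ((n%:R * (E * r)) ^+ size b * M).
    have [t t01 ->] := meval_upd_mvt (P x') w j (meval w (Phi x')) (meval w (Phi x)).
    rewrite normrM; apply: ler_pM => //.
    apply: (flat_bound (I := I) (y := c x')) => //.
    - by rewrite (ltW Er0).
    - exact: supp_upd.
    - rewrite -[X in sup_close _ _ X](upd_id (c x') j) -[X in sup_close _ _ X](upd_upd _ _ 0).
      apply: sup_close_upd; first by apply: sup_close_le wx'; rewrite ler_peMl.
      exact: between_close.
    - exact: bounded_jet_mderiv.
    - exact: st'.
  rewrite !meval_subst_var -/u -/v.
  rewrite (le_trans (ler_distD (meval u (P x')) _ _))// (le_trans (lerD PP step3))//.
  rewrite le_eqVlt; apply/orP; left; apply/eqP.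
  by rewrite !exprMn !exprD; ring.
- move=> x Ax; have [Ix _ MP st _] := hA _ Ax.
  have P'x : meval (upd (c x) j 0) (P' x) = meval (c x) (P x).
    by rewrite meval_subst_var Phi0// upd_upd upd_id.
  split=> // i; rewrite !inE => /andP[ij iI] [|//] _ _.
  (* The substituted point stays within [E * t] of [c x], where [P x] varies by at most [T * t * t],
     its own first derivatives along [I] being zero at [c x]. *)
  apply: mderiv_eq0 => e e0; rewrite P'x.
  pose T := n%:R * (E * (n%:R * E * M)).
  have T0 : 0 <= T by rewrite !mulr_ge0// ltW.
  exists (Num.min (Num.min d1 E^-1) (e / (T + 1))).
    by rewrite !lt_min d10 invr_gt0 E0 divr_gt0// ltr_wpDl.
  move=> t /andP[t0]; rewrite !le_min => /andP[/andP[td tE] tT].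
  rewrite meval_subst_var; set w := fun k => _.
  have Et0 : 0 < E * t by rewrite mulr_gt0.
  have Et1 : E * t <= 1 by rewrite -ler_pdivlMl// mulr1.
  have Iw : supp (I :\ j) w.
    move=> k kI; rewrite /w (supp_upd0 Ix kI) add0r; case: eqP => [ki|_].
      by move: kI; rewrite ki !inE ij iI.
    by rewrite mul0r.
  have wx : sup_close t w (upd (c x) j 0).
    move=> k; rewrite /w addrAC subrr add0r normrM (gtr0_norm t0).
    by rewrite ler_piMl ?(ltW t0)//; case: eqP => _; rewrite ?normr1 ?normr0.
  have wE : sup_close (E * t) (upd w j (meval w (Phi x))) (c x).
    by apply: PhiE => //; rewrite ltW.
  have st1 : stationary I 1 (c x) (P x).
    by move=> k kI b' b'I b's; apply: st => //; rewrite (leq_trans b's).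
  have := stationary_bound M0 _ Ix (supp_upd _ jI Iw) wE MP st1.
  rewrite (ltW Et0) Et1 => /(_ isT) /le_trans; apply.
  rewrite expr1; apply: (@le_trans _ _ (T * t * t)).
    by rewrite le_eqVlt; apply/orP; left; apply/eqP; rewrite /T; ring.
  rewrite ler_wpM2r ?(ltW t0)//; move: tT; rewrite ler_pdivlMr ?ltr_wpDl// => h.
  by rewrite (le_trans _ h)// mulrC ler_wpM2l ?(ltW t0)// lerDl.
Qed.

End Elimination.

(** * Lebesgue outer measure *)

Section OuterMeasure.
Variable R : realType.
Local Notation lom := (@lebesgue_outer_measure R).

Lemma lom_ge0 S : (0 <= lom S)%E.
Proof. exact: mu_ext_ge0. Qed.

Lemma lom0 : lom set0 = 0%E.
Proof. exact: mu_ext0. Qed.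

Lemma le_lom (S T : set R) : S `<=` T -> (lom S <= lom T)%E.
Proof. exact: (@le_mu_ext _ (ocitv_type R) R (@wlength R idfun)). Qed.

Lemma lom_sigma_subadditive (F : nat -> set R) :
  (lom (\bigcup_k F k) <= \sum_(k <oo) lom (F k))%E.
Proof. exact: (@mu_ext_sigma_subadditive _ (ocitv_type R) R (@wlength R idfun)). Qed.

Lemma lom_diameter (S : set R) (L : R) : 0 <= L ->
  (forall x y, S x -> S y -> `|x - y| <= L) -> (lom S <= (2 * L)%:E)%E.
Proof.
move=> L0 SL; have [->|/set0P[x Sx]] := eqVneq S set0.
  by rewrite lom0 lee_fin mulr_ge0.
have h : lom `[x - L, x + L]%classic = (2 * L)%:E.
  transitivity (@lebesgue_measure R `[x - L, x + L]%classic) => //.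
  rewrite lebesgue_measure_itv/= lte_fin -EFinB.
  case: ltP => [_|h]; first by congr (_ %:E); ring.
  by congr (_ %:E); lra.
rewrite -h; apply: le_lom => y Sy /=; rewrite in_itv/= -ler_distlC.
exact: SL.
Qed.

Lemma lom_finite_cover (T : finType) (P : pred T) (S : set R) (G : T -> set R) :
  (forall y, S y -> exists2 t, P t & G t y) -> (lom S <= \sum_(t | P t) lom (G t))%E.
Proof.
move=> h; apply: (@le_trans _ _ (lom (\big[setU/set0]_(t | P t) G t))).
  apply: le_lom => y /h[t Pt Gt].
  by rewrite -(bigcup_seq_cond (index_enum T) G P); exists t; rewrite //= mem_index_enum.
pose mu := [the outer_measure _ _ of mu_ext (@wlength R idfun)].
elim/big_rec2: _ => [|t U s _ IH]; first by rewrite lom0.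
by apply: (le_trans (outer_measureU2 mu _ _)); exact: leeD2l.
Qed.

Lemma lom_null_cover (I : countType) X (A : set X) (F : X -> R) (B : I -> set X) :
  (forall x, A x -> exists i, B i x) -> (forall i, lom (F @` (A `&` B i)) = 0%E) ->
  lom (F @` A) = 0%E.
Proof.
move=> AB B0; apply/eqP; rewrite eq_le lom_ge0 andbT.
pose G k := if unpickle k is Some i then F @` (A `&` B i) else set0.
apply: (@le_trans _ _ (lom (\bigcup_k G k))).
  apply: le_lom => _ [x Ax <-]; have [i Bix] := AB x Ax.
  by exists (pickle i) => //; rewrite /G pickleK; exists x.
apply: (le_trans (lom_sigma_subadditive _)).
rewrite eseries0// => k _ _; rewrite /G; case: unpickle => [i|]; first exact: B0.
exact: lom0.
Qed.

End OuterMeasure.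

(** * Images of flat functions *)

Section FlatImage.
Variable R : realType.
Local Notation lom := (@lebesgue_outer_measure R).

Lemma unit_cell N (t : R) : 0 <= t <= N.+1%:R ->
  exists k : 'I_N.+1, k%:R <= t <= k%:R + 1.
Proof.
elim: N => [|N IH] /andP[t0 tN]; first by exists ord0; rewrite t0 add0r.
have [tN'|tN'] := leP t N.+1%:R.
  by have [k kt] := IH (introT andP (conj t0 tN')); exists (widen_ord (leqnSn _) k).
by exists ord_max; rewrite (ltW tN')/= natr1.
Qed.

Lemma itv_dist (b v w r : R) : b <= v <= b + r -> b <= w <= b + r -> `|v - w| <= r.
Proof. by move=> /andP[? ?] /andP[? ?]; rewrite ler_norml; apply/andP; split; lra. Qed.

Lemma dist3 (a b c e r : R) : `|a - b| <= r -> `|b - c| <= r -> `|e - c| <= r ->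
  `|a - e| <= 3 * r.
Proof.
rewrite !ler_norml => /andP[? ?] /andP[? ?] /andP[? ?].
by apply/andP; split; lra.
Qed.

Variables (X : Type) (A : set X) (d s : nat) (u : X -> 'I_d -> R) (F : X -> R).
Variable K : R.
Hypotheses (K0 : 0 <= K) (s2 : (2 <= s)%N) (ds : (d <= s)%N).
Hypothesis FK : forall x x' r, A x -> A x' -> 0 < r ->
  (forall i, `|u x i - u x' i| <= r) -> `|F x - F x'| <= K * r ^+ s.

Let box (a : 'I_d -> R) (r : R) : set X :=
  [set x | A x /\ forall i, a i <= u x i <= a i + r].

Let cell N (a : 'I_d -> R) (r : R) (f : {ffun 'I_d -> 'I_N}) :=
  box (fun i => a i + (f i)%:R * (r / N%:R)) (r / N%:R).
Arguments cell : clear implicits.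

Let cell_cover N a r (v : 'I_d -> R) : 0 < r ->
  (forall i, a i <= v i <= a i + r) ->
  exists f : {ffun 'I_d -> 'I_N.+1}, forall i,
    a i + (f i)%:R * (r / N.+1%:R) <= v i <= a i + (f i)%:R * (r / N.+1%:R) + r / N.+1%:R.
Proof.
move=> r0 av; have rN : 0 < r / N.+1%:R by rewrite divr_gt0.
have /choice[f hf] i : exists k : 'I_N.+1,
    a i + k%:R * (r / N.+1%:R) <= v i <= a i + k%:R * (r / N.+1%:R) + r / N.+1%:R.
  have /andP[v1 v2] := av i.
  have [|k /andP[k1 k2]] := @unit_cell N ((v i - a i) / (r / N.+1%:R)).
    rewrite divr_ge0 ?subr_ge0 ?(ltW rN)//= ler_pdivrMr// mulrCA divff ?pnatr_eq0// mulr1.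
    by rewrite lerBlDl.
  exists k; move: k1 k2; rewrite ler_pdivlMr// ler_pdivrMr// mulrDl mul1r.
  move: (r / _) (k%:R * _) => *.
  by apply/andP; split; lra.
by exists [ffun i => f i] => i; rewrite ffunE.
Qed.

(* If no cell is empty, a chain of [N] short steps between nearby points joins
   any two points; as [2 <= s], this beats the direct estimate. *)
Let chain_bound N a r x x' : 0 < r -> box a r x -> box a r x' ->
  (forall f, exists y, cell N.+1 a r f y) ->
  `|F x - F x'| <= N.+1%:R * (K * (3 * (r / N.+1%:R)) ^+ s).
Proof.
move=> r0 [Ax ax] [Ax' ax'] full; set M : R := N.+1%:R; have rM : 0 < r / M by rewrite divr_gt0.
have M0 : 0 < M by [].
pose p (t : nat) i := u x i + (u x' i - u x i) * (t%:R / M).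
have /choice[y hy] (t : nat) : exists y, (t <= N.+1)%N ->
    A y /\ forall i, `|u y i - p t i| <= r / M.
  have [tN|tN] := leqP t N.+1; last by exists x.
  have t01 : 0 <= t%:R / M <= 1.
    by rewrite divr_ge0//= ler_pdivrMr// mul1r ler_nat.
  have pa i : a i <= p t i <= a i + r.
    move: (ax i) (ax' i) t01; rewrite /p; move: (t%:R / M) (u x i) (u x' i) => th v v'.
    move=> /andP[v1 v2] /andP[v1' v2'] /andP[th0 th1].
    have -> : v + (v' - v) * th = (1 - th) * v + th * v' by ring.
    have th1' : 0 <= 1 - th by rewrite subr_ge0.
    rewrite {1}(_ : a i = (1 - th) * a i + th * a i); last by ring.
    rewrite (_ : a i + r = (1 - th) * (a i + r) + th * (a i + r)); last by ring.
    by apply/andP; split; apply: lerD; exact: ler_wpM2l.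
  have [f hf] := cell_cover N r0 pa; have [y [Ay yf]] := full f.
  by exists y => _; split => // i; exact: itv_dist (yf i) (hf i).
pose g t := if t == 0%N then x else if t == N.+1 then x' else y t.
have hg t : (t <= N.+1)%N -> A (g t) /\ forall i, `|u (g t) i - p t i| <= r / M.
  move=> tN; rewrite /g /p; case: eqP => [->|_].
    by split => // i; rewrite mul0r mulr0 addr0 subrr normr0 ltW.
  case: eqP => [->|_]; last exact: hy.
  by split => // i; rewrite divff ?gt_eqF// mulr1 subrKC subrr normr0 ltW.
(* In the radius [3 * (r / M)], one [r / M] is the advance along the segment and the two others are
   the deviations of the chain from it. *)
have step t : (t < N.+1)%N -> `|F (g t.+1) - F (g t)| <= K * (3 * (r / M)) ^+ s.
  move=> tN; have [A1 h1] := hg _ tN; have [A2 h2] := hg _ (ltnW tN).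
  apply: FK => // [|i]; first by rewrite mulr_gt0.
  have : `|p t.+1 i - p t i| <= r / M.
    have -> : p t.+1 i - p t i = (u x' i - u x i) / M.
      by rewrite /p -natr1; field; rewrite gt_eqF.
    rewrite normrM (gtr0_norm (x := M^-1)) ?invr_gt0// ler_wpM2r ?invr_ge0//.
    exact: itv_dist (ax' i) (ax i).
  by move=> h; exact: dist3 (h1 i) h (h2 i).
have -> : F x - F x' = - \sum_(0 <= t < N.+1) (F (g t.+1) - F (g t)).
  by rewrite (telescope_sumr (fun t => F (g t)))// opprB /g eqxx/= eqxx.
rewrite normrN (le_trans (ler_norm_sum _ _ _))// big_mkord.
apply: (@le_trans _ _ (\sum_(t < N.+1) K * (3 * (r / M)) ^+ s)).
  by apply: ler_sum => t _; exact: step.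
by rewrite sumr_const card_ord -[leLHS]mulr_natl.
Qed.

(** Induction on the number [j] of subdivisions. If every cell meets [A], [chain_bound] gives the
    first term. Otherwise at most [N.+1 ^ d - 1] cells count, and adding up their bounds brings the
    factor [1 - N.+1%:R^-1 ^+ d]. *)
Let box_bound N j a r : 0 < r <= 1 ->
  (lom (F @` box a r) <=
   ((2 * (N.+1%:R * (K * (3 / N.+1%:R) ^+ s)) + (1 - N.+1%:R^-1 ^+ d) ^+ j * (2 * K))
    * r ^+ d)%:E)%E.
Proof.
set M : R := N.+1%:R; set B1 := 2 * (M * _).
have M0 : 0 < M by [].
have M1 : 1 <= M by rewrite /M ler1n.
have iM1 : M^-1 <= 1 by rewrite invf_le1.
have th0 : 0 <= 1 - M^-1 ^+ d by rewrite subr_ge0 exprn_ile1// invr_ge0 ltW.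
have B10 : 0 <= B1 by rewrite !mulr_ge0 ?exprn_ge0 ?divr_ge0// ltW.
(* The order [s] is traded for the dimension [d], the exponent for which the bounds on cells add up
   like volumes. *)
have rds r' : 0 < r' <= 1 -> r' ^+ s <= r' ^+ d.
  by move=> /andP[r0 r1]; apply: ler_wiXn2l => //; exact: ltW.
elim: j a r => [|j IH] a r /andP[r0 r1].
  rewrite expr0 mul1r; apply: (@le_trans _ _ (2 * (K * r ^+ d))%:E).
    apply: lom_diameter; first by rewrite mulr_ge0// exprn_ge0// ltW.
    move=> _ _ [x [Ax ax] <-] [x' [Ax' ax'] <-].
    rewrite (le_trans (FK (r := r) Ax Ax' r0 _))//.
      by move=> i; exact: itv_dist (ax i) (ax' i).
    by rewrite ler_wpM2l// rds// r0.
  by rewrite lee_fin mulrA ler_wpM2r ?exprn_ge0 ?(ltW r0)// lerDr.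
have [full|/existsNP[f0 nf0]] := pselect (forall f, exists y, cell N.+1 a r f y).
  apply: (@le_trans _ _ (2 * (M * (K * (3 * (r / M)) ^+ s)))%:E).
    apply: lom_diameter.
      by rewrite !mulr_ge0 ?exprn_ge0 ?mulr_ge0 ?invr_ge0// ltW.
    by move=> _ _ [x ax <-] [x' ax' <-]; exact: chain_bound full.
  rewrite lee_fin [leRHS]mulrDl -[leLHS]addr0; apply: lerD; last first.
    by rewrite !mulr_ge0 ?exprn_ge0// ltW.
  have -> : 3 * (r / M) = 3 / M * r by rewrite mulrCA mulrC.
  rewrite exprMn !mulrA -/B1 -mulrA /B1 !mulrA.
  by rewrite ler_wpM2l ?rds ?r0// !mulr_ge0 ?exprn_ge0 ?divr_ge0// ltW.
have rM0 : 0 < r / M by rewrite divr_gt0.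
have rM1 : r / M <= 1 by rewrite ler_pdivrMr// mul1r (le_trans r1).
set B := B1 + (1 - M^-1 ^+ d) ^+ j * (2 * K) in IH.
apply: (@le_trans _ _ (\sum_(f : {ffun 'I_d -> 'I_N.+1} | f != f0) lom (F @` cell N.+1 a r f))%E).
  apply: lom_finite_cover => _ [x [Ax ax] <-].
  have [f hf] := cell_cover N r0 ax; exists f.
    by apply: contra_notN nf0 => /eqP <-; exists x.
  by exists x.
apply: (@le_trans _ _ (\sum_(f : {ffun 'I_d -> 'I_N.+1} | f != f0) (B * (r / M) ^+ d)%:E)%E).
  by apply: lee_sum => f _; apply: IH; rewrite rM0.
rewrite sumEFin lee_fin sumr_const.
have -> : #|[pred f : {ffun 'I_d -> 'I_N.+1} | f != f0]| = (N.+1 ^ d).-1.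
  have := cardC1 f0; rewrite card_ffun !card_ord => <-; apply: eq_card => f.
  by rewrite !inE.
have -> : B * (r / M) ^+ d *+ (N.+1 ^ d).-1 = (1 - M^-1 ^+ d) * B * r ^+ d.
  have Nd : (0 < N.+1 ^ d)%N by rewrite expn_gt0.
  rewrite -mulr_natr -subn1 natrB// natrX -/M exprMn exprVn.
  by field; rewrite expf_neq0// gt_eqF.
(* Only the term with the power [j] has to shrink; on [B1] the factor is just bounded by 1. *)
rewrite ler_wpM2r ?exprn_ge0 ?(ltW r0)// /B mulrDr exprS mulrA lerD2r.
by rewrite ler_piMl// lerBlDr lerDl exprn_ge0// invr_ge0 ltW.
Qed.

(** The mesh is fixed first: as [2 <= s], the chain term is [O(1 / N)]. The number [j] of
    subdivisions comes afterwards, because the ratio [1 - N.+1%:R^-1 ^+ d] depends on [N]. *)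
Lemma flat_image_null_box a : (forall x, A x -> forall i, a i <= u x i <= a i + 1) ->
  lom (F @` A) = 0%E.
Proof.
move=> Aa; apply/eqP; rewrite eq_le lom_ge0 andbT.
apply/lee_addgt0Pr => e e0; rewrite add0e.
have -> : A = box a 1.
  by apply/seteqP; split => x; [move=> Ax; split => //; exact: Aa|case].
(* For [M] at least [Y], the bound [2 * (3 ^+ s * K) / M] of the chain term is at most [e / 2]. *)
pose Y := 4 * (3 ^+ s * K) / e.
have Y0 : 0 <= Y by rewrite divr_ge0 ?(ltW e0)// !mulr_ge0// exprn_ge0.
pose N := Num.Def.archi_bound Y; have YN : Y < N.+1%:R.
  by rewrite (lt_trans (archi_boundP Y0))// ltr_nat.
pose M : R := N.+1%:R; have M0 : 0 < M by [].
have M1 : 1 <= M by rewrite /M ler1n.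
have th1 : `|1 - M^-1 ^+ d| < 1.
  have h : 0 < M^-1 ^+ d by rewrite exprn_gt0// invr_gt0.
  have h' : M^-1 ^+ d <= 1 by rewrite exprn_ile1// ?invf_le1// invr_ge0 ltW.
  by rewrite ger0_norm ?subr_ge0// ltrBlDr ltrDl.
have e1 : 0 < e / (4 * K + 1) by rewrite divr_gt0// ltr_wpDl// mulr_ge0.
have /cvgrPdist_lt /(_ _ e1) [j _ /(_ j (leqnn j))] := cvg_expr th1.
rewrite /= sub0r normrN => thj.
apply: (le_trans (@box_bound N j a 1 _)); first by rewrite ltr01 lexx.
rewrite expr1n mulr1 lee_fin -/M.
have -> : e = e / 2 + e / 2 by field.
apply: lerD.
  have h : (3 / M) ^+ s <= 3 ^+ s / (M * M).
    rewrite exprMn exprVn ler_wpM2l ?exprn_ge0// lef_pV2 ?posrE ?exprn_gt0 ?mulr_gt0//.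
    by rewrite -expr2 ler_weXn2l.
  apply: (@le_trans _ _ (2 * (M * (K * (3 ^+ s / (M * M)))))).
    by rewrite !ler_wpM2l// ltW.
  have -> : 2 * (M * (K * (3 ^+ s / (M * M)))) = 2 * (3 ^+ s * K) / M.
    by field; rewrite gt_eqF.
  move: (ltW YN); rewrite /Y -/M !ler_pdivrMr//; lra.
apply: (le_trans (ler_norm _)); rewrite normrM (ger0_norm (x := 2 * K)) ?mulr_ge0//.
rewrite normrX in thj; rewrite normrX.
move: (ltW thj); rewrite ler_pdivlMr ?ltr_wpDl ?mulr_ge0// => h.
have := exprn_ge0 j (normr_ge0 (1 - M^-1 ^+ d)); lra.
Qed.

End FlatImage.

(** * Localization to small pieces *)

Section SmallPieces.
Variables (R : realType) (n : nat) (X : Type).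

(** A grid of mesh [eta] has countably many cells, indexed by integer vectors; estimates valid at
    small scale therefore suffice. *)
Lemma small_pieces_null (A : set X) (c : X -> 'I_n -> R) (F : X -> R) (eta : R) :
  0 < eta ->
  (forall B : set X, B `<=` A ->
     (forall x x', B x -> B x' -> sup_close eta (c x) (c x')) ->
     lebesgue_outer_measure (F @` B) = 0%E) ->
  lebesgue_outer_measure (F @` A) = 0%E.
Proof.
move=> eta0 h.
apply: (@lom_null_cover R {ffun 'I_n -> int} X A F
  (fun m => [set x | forall i, Num.floor (c x i / eta) = m i])).
  by move=> x _; exists [ffun i => Num.floor (c x i / eta)] => i; rewrite ffunE.
move=> m; apply: h => [x []//|x x' [_ /= xm] [_ /= x'm] i].
have := floor_itv (c x i / eta); have := floor_itv (c x' i / eta).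
rewrite xm x'm !ler_pdivlMr// !ltr_pdivrMr// => /andP[? ?] /andP[? ?].
rewrite ler_norml; move: (m i) => k *; apply/andP; split; lra.
Qed.

(** Enumerating [I] gives a space of dimension [#|I|], and a piece whose points are within 1/2 of
    each other fits in a unit cube centred at any of them. *)
Lemma flat_image_null (A : set X) (c : X -> 'I_n -> R) (F : X -> R)
    (I : {set 'I_n}) (s : nat) (K eta : R) :
  0 <= K -> 0 < eta -> (2 <= s)%N -> (#|I| <= s)%N ->
  (forall x, A x -> supp I (c x)) ->
  (forall x x' r, A x -> A x' -> 0 < r <= eta -> sup_close r (c x) (c x') ->
     `|F x - F x'| <= K * r ^+ s) ->
  lebesgue_outer_measure (F @` A) = 0%E.
Proof.
move=> K0 eta0 s2 Is cI FK.
pose e : R := Num.min eta 2^-1; have e0 : 0 < e by rewrite lt_min eta0 invr_gt0 ltr0n.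
have e12 : e <= 2^-1 by rewrite ge_min lexx orbT.
have ee : e <= eta by rewrite ge_min lexx.
apply: (small_pieces_null (c := c) e0) => B BA Be.
have [->|/set0P[x0 Bx0]] := eqVneq B set0; first by rewrite image_set0 lom0.
pose u x (i : 'I_#|I|) := c x (enum_val i).
apply: (@flat_image_null_box R X B #|I| s u F K K0 s2 Is _ (fun i => u x0 i - 2^-1)).
  move=> x x' r Bx Bx' r0 ur.
  have rc : sup_close r (c x) (c x').
    move=> i; have [iI|iI] := boolP (i \in I).
      by have := ur (enum_rank_in iI i); rewrite /u enum_rankK_in.
    by rewrite (cI _ (BA _ Bx))// (cI _ (BA _ Bx'))// subrr normr0 ltW.
  have [re|re] := leP r e.
    by apply: FK => //; [exact: BA|exact: BA|rewrite r0 (le_trans re)].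
  (* Radii above [e] reduce to [e], any two points of the piece being that close. *)
  apply: (@le_trans _ _ (K * e ^+ s)).
    by apply: FK => //; [exact: BA|exact: BA|rewrite e0|exact: Be].
  by rewrite ler_wpM2l// lerXn2r ?nnegrE ?(ltW re)// ltW.
move=> x Bx i; have := Be _ _ Bx Bx0 (enum_val i); rewrite ler_norml /u => /andP[? ?].
by apply/andP; split; lra.
Qed.

End SmallPieces.

(** * Induction on the dimension *)

Section Stage.
Variables (R : realType) (n : nat) (X : Type).
Implicit Types (A : set X) (c : X -> 'I_n -> R) (I : {set 'I_n}).
Implicit Types (P : X -> mpoly n R) (w y z : 'I_n -> R) (F : X -> R).

(** The points are abstract parameters [x] located at [c x]: eliminating a variable changes [c] and
    [P] but neither [A] nor [F], so the image under study stays the same. *)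
Definition jet_sard I s := forall A c P F (K d : R), 0 <= K -> 0 < d ->
  compat A c I P s K d ->
  (forall x, A x -> [/\ supp I (c x), F x = meval (c x) (P x) &
                        stationary I 1 (c x) (P x)]) ->
  lebesgue_outer_measure (F @` A) = 0%E.

(** On pieces so small that the slope along [j] stays above [c0 / 2], [zero_set_lipschitz] presents
    the set as a Lipschitz graph; [eliminate_variable] then provides the data for [jet_sard] in one
    variable less. *)
Lemma nonflat_null A c I P F b j (M c0 K d eta0 : R) D q :
  jet_sard (I :\ j) (q.+1 + size b) ->
  0 <= M -> 0 < c0 -> 0 <= K -> 0 < d -> 0 < eta0 ->
  all (fun i => i \in I) b -> j \in I -> (0 < size b)%N ->
  (forall x, A x -> [/\ supp I (c x), (msize (P x) <= D)%N,
     bounded_jet M (P x) (c x), stationary I (size b) (c x) (P x) &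
     meval (c x) (dword b (P x)) = 0 /\
     c0 <= `|meval (c x) (mderiv j (dword b (P x)))|]) ->
  compat A c I P (q.+1 + size b) K d ->
  (forall x, A x -> F x = meval (c x) (P x)) ->
  (forall x x' r, A x -> A x' -> 0 < r <= eta0 -> sup_close r (c x) (c x') ->
    `|meval (c x') (dword b (P x))| <= c0 / 4 * r) ->
  lebesgue_outer_measure (F @` A) = 0%E.
Proof.
move=> IH M0 c00 K0 d0 e0 bI jI b0 hA cP FP hG.
have nM0 : 0 < n%:R * M + 1 by rewrite ltr_wpDl// mulr_ge0.
pose eta := Num.min eta0 (Num.min 1 (c0 / 2 / (n%:R * M + 1))).
have eta_gt0 : 0 < eta by rewrite !lt_min e0 ltr01 !divr_gt0.
have [ee e1 ec] : [/\ eta <= eta0, eta <= 1 & eta <= c0 / 2 / (n%:R * M + 1)].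
  by split; rewrite !ge_min lexx ?orbT.
apply: (small_pieces_null (c := c) eta_gt0) => B BA Be.
have lipB x x' r : B x -> B x' -> 0 <= r ->
    sup_close r (upd (c x) j 0) (upd (c x') j 0) ->
    `|c x j - c x' j| <= (1 + 4 * n%:R * M / c0) * r.
  apply: (@zero_set_lipschitz R n X B c I (fun x => dword b (P x)) j M c0 eta) => //.
  - by rewrite eta_gt0.
  - move: ec; rewrite ler_pdivlMr// => ec; apply: le_trans ec.
    by rewrite mulrCA ler_wpM2l ?(ltW eta_gt0)// lerDl.
  - move=> y /BA /hA[Iy _ My _ [Gy cGy]]; split => //.
    exact: bounded_jet_dword.
  move=> y y' t By By' t0 yy'; have [te|et] := leP t eta.
    by apply: hG => //; [exact: BA|exact: BA|rewrite t0 (le_trans te)].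
  apply: (@le_trans _ _ (c0 / 4 * eta)).
    by apply: hG => //; [exact: BA|exact: BA|rewrite eta_gt0|exact: Be].
  by rewrite ler_wpM2l ?divr_ge0 ?(ltW c00)// ltW.
have cB : compat B c I P (q.+1 + size b) K d.
  by move=> x x' /BA Ax /BA Ax'; exact: cP.
have L0 : 0 <= 1 + 4 * n%:R * M / c0.
  by rewrite addr_ge0// divr_ge0 ?(ltW c00)// !mulr_ge0.
have [|P' [K' [d' [K'0 d'0 cP' hP']]]] :=
    @eliminate_variable R n X B c I P b j M c0 _ K d D q M0 c00 L0 K0 d0 bI jI b0 _ cB lipB.
  by move=> x /BA; exact: hA.
apply: (IH _ _ _ _ _ _ K'0 d'0 cP') => x Bx; have [e st] := hP' x Bx; split => //.
  by apply: supp_upd0; have [] := hA x (BA x Bx).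
by rewrite e FP//; exact: BA.
Qed.

(** The single integer [N] controls the degree, the jet and the slope: there are countably many
    strata, with uniform constants on each. *)
Definition nonflat_at N b j I s c P : set X := [set x |
  [/\ all (fun i => i \in I) b && (j \in I) && (0 < size b < s)%N,
      (msize (P x) <= N)%N, bounded_jet N%:R (P x) (c x),
      stationary I (size b) (c x) (P x) &
      meval (c x) (dword b (P x)) = 0 /\
      N.+1%:R^-1 <= `|meval (c x) (mderiv j (dword b (P x)))|]].

Definition flat_at N I s c P : set X :=
  [set x | stationary I s (c x) (P x) /\ bounded_jet N%:R (P x) (c x)].

(** Where flatness to order [s] fails, [first_jet] gives [b] and [j], and [N] is taken large enough
    for the degree, the jet and the inverse slope at the point. The index [None] stands for the flat
    stratum. *)
Lemma strata_null A c I P F s :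
  (forall x, A x -> stationary I 1 (c x) (P x)) ->
  (forall N, lebesgue_outer_measure (F @` (A `&` flat_at N I s c P)) = 0%E) ->
  (forall N b j, lebesgue_outer_measure (F @` (A `&` nonflat_at N b j I s c P)) = 0%E) ->
  lebesgue_outer_measure (F @` A) = 0%E.
Proof.
move=> A1 hflat hnonflat.
apply: (@lom_null_cover R (nat * option (seq 'I_n * 'I_n))%type X A F (fun k =>
  if k.2 is Some bj then nonflat_at k.1 bj.1 bj.2 I s c P else flat_at k.1 I s c P)).
  move=> x Ax; have [N hN] := bounded_jet_ex (P x) (c x).
  have [st|nst] := pselect (stationary I s (c x) (P x)); first by exists (N, None).
  have [b [j [bjI bs st Gx dGx]]] := first_jet (A1 _ Ax) nst.
  pose a := `|meval (c x) (mderiv j (dword b (P x)))|.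
  have a0 : 0 < a by rewrite normr_gt0.
  pose N' := maxn (maxn N (msize (P x))) (Num.Def.archi_bound a^-1).
  exists (N', Some (b, j)); rewrite /nonflat_at /=; split => //.
  - by rewrite bjI.
  - by rewrite /N' !leq_max leqnn orbT.
  - by apply: bounded_jet_le hN; rewrite ler_nat /N' !leq_max leqnn.
  split => //; rewrite -/a -[leRHS]invrK lef_pV2 ?posrE ?invr_gt0//.
  rewrite ltW// (lt_le_trans (archi_boundP _)) ?invr_ge0 ?(ltW a0)//.
  by rewrite ler_nat leqW// /N' leq_max leqnn orbT.
by case=> N [[b j]|] /=.
Qed.

(** Induction on [#|I|] at constant order: the flat stratum falls under [flat_image_null], and on
    the others one variable is eliminated. *)
Lemma jet_sardP I s : (2 <= s)%N -> (#|I| <= s)%N -> jet_sard I s.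
Proof.
(* The order is now [s.+1]. Flatness [s] of the first derivatives and one more mean value step give
   exactly this order on the flat stratum. *)
case: s => // s s2; have [m] := ubnP #|I|.
elim: m I => // m IH I Im Is A c P F K d K0 d0 cP hA.
have [AI AF A1] : [/\ forall x, A x -> supp I (c x),
    forall x, A x -> F x = meval (c x) (P x) &
    forall x, A x -> stationary I 1 (c x) (P x)] by split => x /hA[].
apply: (@strata_null A c I P F s) => // N.
  apply: (@flat_image_null R n X _ c F I s.+1
    (K + n%:R * n%:R ^+ s * N%:R) (Num.min d 1)) => //.
  - by rewrite addr_ge0// !mulr_ge0// exprn_ge0.
  - by rewrite lt_min d0 ltr01.
  - by move=> x [Ax _]; exact: AI.
  move=> x x' r [Ax _] [Ax' [st' MP']] /andP[r0]; rewrite le_min => /andP[rd r1] xx'.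
  rewrite (AF _ Ax) (AF _ Ax') (le_trans (ler_distD (meval (c x) (P x')) _ _))//.
  rewrite mulrDl lerD//.
    by apply: cP => //; [exact: AI|rewrite r0|exact: sup_close_refl (ltW r0)].
  have -> : n%:R * n%:R ^+ s * N%:R * r ^+ s.+1 = n%:R * (r * ((n%:R * r) ^+ s * N%:R)).
    by rewrite exprMn exprS; ring.
  apply: (stationary_bound (I := I)) => //; first by rewrite (ltW r0).
  - exact: AI.
  - exact: AI.
move=> b j; set B := _ `&` _.
have [->|/set0P[x0 [_ [/andP[/andP[bI jI] /andP[b0 bs]] _ _ _ _]]]] := eqVneq B set0.
  by rewrite image_set0 lom0.
pose q := (s - size b)%N; have sE : (q.+1 + size b)%N = s.+1.
  by rewrite /q addSn subnK// ltnW.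
(* Since [q] is positive, a remainder of order [q.+1] for [G] falls below [c0 / 4 * r] at small
   scale. *)
have q0 : (0 < q)%N by rewrite /q subn_gt0.
have [C C0 hC] := @compat_dword R n X N q.+1 (size b).
have cB : compat B c I P (q.+1 + size b) K d.
  by rewrite sE => x x' [Ax _] [Ax' _]; exact: cP.
have cG : compat B c I (fun x => dword b (P x)) q.+1 (C * K) (d / 2 ^+ size b).
  by apply: hC => // x [_ []].
have CK0 : 0 < C * K + 1 by rewrite ltr_wpDl// mulr_ge0.
pose c0 : R := N.+1%:R^-1; have c00 : 0 < c0 by rewrite invr_gt0.
pose eta := Num.min (d / 2 ^+ size b) (Num.min 1 (c0 / 4 / (C * K + 1))).
have eta0 : 0 < eta by rewrite !lt_min ltr01 !divr_gt0// exprn_gt0.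
apply: (@nonflat_null B c I P F b j N%:R c0 K d eta N q) => //.
- rewrite sE; apply: IH.
  + by move: Im; rewrite (cardsD1 j I) jI add1n ltnS.
  + by rewrite (leq_trans _ Is)// subset_leq_card// subD1set.
- by move=> x [Ax [_ ? ? ? ?]]; split => //; exact: AI.
- by move=> x [Ax _]; exact: AF.
move=> x x' r Bx Bx' /andP[r0]; rewrite !le_min => /andP[rd /andP[r1 rc]] xx'.
have [Ax' [_ _ _ _ [Gx' _]]] := Bx'.
rewrite -[meval _ _]subr0 -Gx'.
apply: (@le_trans _ _ (C * K * r ^+ q.+1)).
  apply: cG => //; first exact: AI.
  - by rewrite r0.
  - exact: sup_close_sym.
  - exact: sup_close_refl (ltW r0).
move: rc; rewrite ler_pdivlMr// => rc.
rewrite exprSr mulrA ler_wpM2r ?(ltW r0)//; apply: le_trans rc.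
rewrite mulrC; apply: ler_pM; rewrite ?exprn_ge0 ?mulr_ge0 ?(ltW r0) ?lerDl//.
by case: q q0 {sE cB cG hC} => // q _; rewrite exprS ler_piMr ?(ltW r0)// exprn_ile1 ?(ltW r0).
Qed.

End Stage.

(** * Taylor polynomials at critical points *)

Section TaylorPolynomial.
Variables (R : realType) (m : nat).
Local Notation n := m.+1.
Implicit Types (w y : 'I_n -> R) (p : mpoly n R) (x h : 'rV[R]_n).

Definition rowv w : 'rV[R]_n := \row_i w i.
Definition coords x : 'I_n -> R := fun i => x 0 i.

Lemma coordsK x : rowv (coords x) = x.
Proof. by apply/rowP => i; rewrite mxE. Qed.

Lemma near_sup_close x (Q : 'rV[R]_n -> Prop) : (\forall y \near x, Q y) ->
  exists2 d : R, 0 < d & forall w, sup_close d w (coords x) -> Q (rowv w).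
Proof.
move=> /nbhs_ballP[e /= e0 he]; exists (e / 2); first by rewrite divr_gt0.
move=> w wx; apply: he; split => // i j /=; rewrite (ord1 i) mxE /ball/= distrC.
by rewrite (le_lt_trans (wx j))// ltr_pdivrMr// ltr_pMr// ltr1n.
Qed.

Lemma near_dnbhs_sup_close (Q : 'rV[R]_n -> Prop) : (\forall h \near (0 : 'rV[R]_n)^', Q h) ->
  exists2 d : R, 0 < d & forall h, h != 0 -> (forall i, `|h 0 i| <= d) -> Q h.
Proof.
move=> /near_sup_close[d d0 hd]; exists d => // h h0 hle.
rewrite -(coordsK h); apply: hd; rewrite ?coordsK// => i.
by rewrite /coords !mxE subr0.
Qed.

Lemma eucl_norm_gt0 h : h != 0 -> 0 < eucl_norm h.
Proof.
move=> h0; rewrite sqrtr_gt0 lt_neqAle sumr_ge0 ?andbT; last by move=> i _; exact: sqr_ge0.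
apply: contra h0; rewrite eq_sym psumr_eq0; last by move=> i _; exact: sqr_ge0.
move=> /allP h0; apply/eqP/rowP => i; rewrite mxE.
by have := h0 i (mem_index_enum _); rewrite /= sqrf_eq0 => /eqP.
Qed.

Lemma eucl_norm_le h (r : R) : 0 <= r -> (forall i, `|h 0 i| <= r) ->
  eucl_norm h <= n%:R * r.
Proof.
move=> r0 hr; rewrite -(@ger0_norm _ (n%:R * r)) ?mulr_ge0// -sqrtr_sqr.
apply: ler_wsqrtr; apply: (@le_trans _ _ (\sum_(i < n) r ^+ 2)).
  apply: ler_sum => i _; rewrite -[leLHS]real_normK ?num_real//.
  by rewrite lerXn2r ?nnegrE.
rewrite sumr_const card_ord -[leLHS]mulr_natl exprMn ler_wpM2r ?exprn_ge0//.
by rewrite expr2 ler_peMl// ler1n.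
Qed.

Lemma homog_meval0 k p : p \is ishomog1 k.+1 mdeg -> meval (fun=> 0) p = 0.
Proof.
move=> /allP hp; rewrite mevalE big_seq big1// => e ep.
have /eqP/= ek := hp e ep.
have : (0 < mdeg e)%N by rewrite ek.
rewrite mdegE => /lt0n_neq0; rewrite sum_nat_eq0 => /forallPn[i]; rewrite /= => ei.
by rewrite (bigD1 i)//= expr0n (negbTE ei) mul0r mulr0.
Qed.

Lemma homog_meval_bound k p : p \is ishomog1 k mdeg ->
  exists2 C : R, 0 <= C & forall w r, 0 <= r -> (forall i, `|w i| <= r) ->
    `|meval w p| <= C * r ^+ k.
Proof.
move=> /allP hp; exists (\sum_(e <- msupp p) `|mcoeff e p|); first exact: sumr_ge0.
move=> w r r0 wr; rewrite mevalE mulr_suml (le_trans (ler_norm_sum _ _ _))//.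
rewrite big_seq [leRHS]big_seq; apply: ler_sum => e ep.
have /eqP/= <- := hp e ep.
rewrite normrM ler_wpM2l// normr_prod mdegE -prodrXr.
apply: ler_prod => i _; rewrite normr_ge0/= normrX lerXn2r ?nnegrE//.
Qed.

(** Taylor polynomials are written in absolute coordinates, so that those at different points can be
    compared at the same [w]. *)
Definition recenter y p : mpoly n R :=
  comp_mpoly [tuple mpolyX R (mnm1 i) - mpolyC n (y i) | i < n] p.

Lemma meval_recenter y p w : meval w (recenter y p) = meval (fun i => w i - y i) p.
Proof.
rewrite comp_mpoly_meval; apply: meval_eq => i.
by rewrite tnth_mktuple mevalB mevalXU mevalC.
Qed.

(** Stationarity comes from [mderiv_eq0], fed with the Taylor estimate and the vanishing
    differential. In the last item [Q], homogeneous of degree [n], is absorbed into the error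
    [C * r ^+ n]. *)
Lemma taylor_polynomial (f : 'rV[R]_n -> R) x : (1 <= m)%N ->
  subdiff_critical n f x -> exists p : mpoly n R,
  [/\ meval (coords x) p = f x,
      forall e, 0 < e -> exists2 d : R, 0 < d & forall w r, 0 < r <= d ->
        sup_close r w (coords x) -> `|f (rowv w) - meval w p| <= e * r ^+ m,
      stationary [set: 'I_n]%SET 1 (coords x) p &
      exists2 C : R, 0 <= C & exists2 d : R, 0 < d & forall w r, 0 < r <= d ->
        sup_close r w (coords x) -> meval w p - C * r ^+ n <= f (rowv w)].
Proof.
move=> m1 [[Q [hQ [P [hP tP] limQ]]] [df df0]].
have /choice[pk hpk] (k : nat) : exists p : mpoly n R, (1 <= k <= m)%N ->
    p \is ishomog1 k mdeg /\ P k = (fun h : 'rV_n => meval (fun i => h 0 i) p).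
  have [km|_] := boolP (1 <= k <= m)%N; last by exists 0.
  by have [p ? ?] := hP k km; exists p.
pose T := mpolyC n (f x) + \sum_(1 <= k < n) recenter (coords x) (pk k).
have TE w : meval w T = f x + \sum_(1 <= k < n) P k (rowv w - x).
  rewrite mevalD mevalC raddf_sum/=; congr (_ + _); apply: eq_big_nat => k km.
  have [_ ->] := hpk k km; rewrite meval_recenter; apply: meval_eq => i.
  by rewrite !mxE.
have T0 : meval (coords x) T = f x.
  rewrite TE big_nat big1 ?addr0// => k km; have [pkh ->] := hpk k km.
  case: k km pkh => // k _ pkh.
  rewrite (meval_eq (v2 := fun=> 0)); first exact: homog_meval0 pkh.
  by move=> i; rewrite coordsK subrr mxE.
have tay e : 0 < e -> exists2 d : R, 0 < d & forall w r, 0 < r <= d ->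
    sup_close r w (coords x) -> `|f (rowv w) - meval w T| <= e * r ^+ m.
  move=> e0; have en0 : 0 < e / n%:R ^+ m by rewrite divr_gt0// exprn_gt0.
  move/cvgrPdist_lt : tP => /(_ _ en0) /near_dnbhs_sup_close[d d0 hd]; exists d => //.
  move=> w r /andP[r0 rd] wx.
  have [w0|w0] := eqVneq (rowv w - x) 0.
    move/eqP: w0; rewrite subr_eq0 => /eqP wE; rewrite wE.
    have -> : w = coords x by apply/funext => i; rewrite -wE /coords mxE.
    by rewrite T0 subrr normr0 mulr_ge0 ?exprn_ge0 ?ltW.
  have wr i : `|(rowv w - x) 0 i| <= r by rewrite !mxE; exact: wx.
  have {hd} := hd _ w0 (fun i => le_trans (wr i) rd).
  rewrite sub0r normrN subrKC -addrA -opprD -TE normrM normfV.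
  have E0 := eucl_norm_gt0 w0; rewrite (@ger0_norm _ (_ ^+ _)) ?exprn_ge0 ?(ltW E0)//.
  rewrite ltr_pdivrMr ?exprn_gt0// => /ltW /le_trans; apply.
  rewrite mulrAC ler_pdivrMr ?exprn_gt0// -mulrA ler_wpM2l ?(ltW e0)//.
  rewrite -exprMn lerXn2r ?nnegrE ?(ltW E0) ?mulr_ge0 ?(ltW r0)//.
  by rewrite mulrC eucl_norm_le// ltW.
exists T; split => //.
- move=> i _ [|//] _ _; apply: mderiv_eq0 => e e0; rewrite T0.
  have e20 : 0 < e / 2 by rewrite divr_gt0.
  have [d1 d10 hd1] := tay _ e20.
  have /diff_locallyP[_ /eqaddoP/(_ _ e20)/near_sup_close[d2 d20 hd2]] := df.
  exists (Num.min (Num.min d1 1) d2); first by rewrite !lt_min d10 ltr01.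
  move=> t /andP[t0]; rewrite !le_min => /andP[/andP[td1 t1] td2].
  set w := fun k => _.
  have wx : sup_close t w (coords x).
    move=> k; rewrite /w addrAC subrr add0r normrM (gtr0_norm t0).
    by rewrite ler_piMl ?(ltW t0)//; case: eqP => _; rewrite ?normr1 ?normr0.
  have h1 : `|f (rowv w) - meval w T| <= e / 2 * t.
    rewrite (le_trans (hd1 w t _ wx)) ?t0// ler_wpM2l ?(ltW e20)//.
    by case: (m) m1 => // k _; rewrite exprS ler_piMr ?(ltW t0)// exprn_ile1 ?(ltW t0).
  have h2 : `|f (rowv w) - f x| <= e / 2 * t.
    pose v k : R := (k == i)%:R * t.
    have vt : forall k, `|v k| <= t.
      move=> k; rewrite /v normrM (gtr0_norm t0).
      by rewrite ler_piMl ?(ltW t0)//; case: eqP => _; rewrite ?normr1 ?normr0.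
    have v0 : sup_close d2 v (coords 0).
      by move=> k; rewrite /coords mxE subr0 (le_trans (vt k)).
    have := hd2 v v0; rewrite df0 /=.
    have -> : (f \o shift x - (cst (f x) + cst 0)) (rowv v) = f (rowv w) - f x.
      rewrite !fctE addr0; congr (f _ - _).
      by apply/rowP => k; rewrite !mxE addrC.
    move/le_trans; apply; rewrite ler_wpM2l ?(ltW e20)//.
    rewrite [leLHS]/Num.Def.normr/= mx_normrE; apply: bigmax_le; first exact: ltW.
    by move=> [k1 k2] _; rewrite mxE.
  have -> : e * t = e / 2 * t + e / 2 * t by field.
  rewrite (le_trans (ler_distD (f (rowv w)) _ _))// lerD// distrC//.
- have [C C0 hC] : exists2 C : R, 0 <= C & forall w r, 0 <= r -> (forall i, `|w i| <= r) ->
    `|Q (rowv w)| <= C * r ^+ n.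
    have [q hq ->] := hQ; have [C C0 hC] := homog_meval_bound hq; exists C => //.
    move=> w r r0 wr; rewrite (meval_eq (v2 := w)); first exact: hC.
    by move=> i; rewrite mxE.
  (* Any negative number would do in place of -1: it bounds the quotient from below near 0, at the
     cost of one more [eucl_norm h ^+ n]. *)
  have : (-1 < limf_einf (fun h : 'rV[R]_n =>
      ((f (x + h) - f x - \sum_(1 <= k < n) P k h - Q h) / eucl_norm h ^+ n)%:E)
      (0 : 'rV[R]_n)^'%R)%E by apply: lt_le_trans limQ; rewrite lte_fin ltrN10.
  rewrite limf_einfE => /ereal_sup_gt[_ [V FV <-] hV].
  have /near_dnbhs_sup_close[d d0 hd] : \forall h \near (0 : 'rV[R]_n)^', V h by [].
  (* [C] pays for [Q], and [n%:R ^+ n] for passing from the Euclidean norm to the sup norm. *)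
  exists (C + n%:R ^+ n); first by rewrite addr_ge0// exprn_ge0.
  exists d => // w r /andP[r0 rd] wx.
  have [w0|w0] := eqVneq (rowv w - x) 0.
    move/eqP: w0; rewrite subr_eq0 => /eqP wE; rewrite wE.
    have -> : w = coords x by apply/funext => i; rewrite -wE /coords mxE.
    rewrite T0 lerBlDr lerDl; apply: mulr_ge0; last by rewrite exprn_ge0// ltW.
    by rewrite addr_ge0// exprn_ge0.
  have wr i : `|(rowv w - x) 0 i| <= r by rewrite !mxE; exact: wx.
  have Vw : V (rowv w - x) by apply: hd => // i; exact: le_trans (wr i) rd.
  have := lt_le_trans hV (ereal_inf_lbound (imageP _ Vw)).
  have E0 := eucl_norm_gt0 w0.
  rewrite lte_fin subrKC ltr_pdivlMr ?exprn_gt0// mulN1r => /ltW hlow.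
  have Qw := hC _ _ (ltW r0) wr; rewrite coordsK in Qw.
  have En : eucl_norm (rowv w - x) ^+ n <= n%:R ^+ n * r ^+ n.
    rewrite -exprMn lerXn2r ?nnegrE ?(ltW E0) ?mulr_ge0 ?(ltW r0)//.
    by rewrite eucl_norm_le// ltW.
  move: Qw; rewrite ler_norml TE mulrDl => /andP[Qw _]; move: hlow En Qw; lra.
Qed.

End TaylorPolynomial.

(** * The image of the critical set *)

Section MorseSard.
Variables (R : realType) (m : nat).
Local Notation n := m.+1.
Local Notation lom := (@lebesgue_outer_measure R).

(** The first stage has order [m] in dimension [m.+1], out of reach of [jet_sardP]. On the flat
    stratum the subdifferential supplies the missing order; on the others, eliminating a variable
    lowers the dimension to [m]. *)
Lemma subdiff_critical_image_null (f : 'rV[R]_n -> R) : (1 <= m)%N ->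
  lom (f @` subdiff_critical n f) = 0%E.
Proof.
move=> m1; set A := subdiff_critical n f; pose c := @coords R m.
pose I := [set: 'I_n]%SET.
have cardI : #|I| = n by rewrite cardsT card_ord.
have /choice[P hP] (x : 'rV[R]_n) : exists p : mpoly n R, A x ->
  [/\ meval (c x) p = f x,
      forall e, 0 < e -> exists2 d : R, 0 < d & forall w r, 0 < r <= d ->
        sup_close r w (c x) -> `|f (rowv w) - meval w p| <= e * r ^+ m,
      stationary I 1 (c x) p &
      exists2 C : R, 0 <= C & exists2 d : R, 0 < d & forall w r, 0 < r <= d ->
        sup_close r w (c x) -> meval w p - C * r ^+ n <= f (rowv w)].
  have [Ax|nAx] := pselect (A x); last by exists 0.
  by have [p hp] := taylor_polynomial m1 Ax; exists p.
apply: (@strata_null R n _ A c I P f m) => [x /hP[]//|N|N b j].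
- set B := A `&` _.
  (* A second countable cover makes the one-sided bound uniform; [k] governs both its constant and
     its radius. *)
  apply: (@lom_null_cover R nat _ B f (fun k => [set x | forall w r, 0 < r <= k.+1%:R^-1 ->
    sup_close r w (c x) -> meval w (P x) - k%:R * r ^+ n <= f (rowv w)])).
    move=> x [/hP[_ _ _ [C C0 [d d0 hC]]] _].
    pose k := maxn (Num.Def.archi_bound C) (Num.Def.archi_bound d^-1).
    exists k => w r /andP[r0 rk] wx.
    have rd : r <= d.
      rewrite (le_trans rk)// -[leRHS]invrK lef_pV2 ?posrE ?invr_gt0//.
      rewrite ltW// (lt_le_trans (archi_boundP _)) ?invr_ge0 ?(ltW d0)//.
      by rewrite ler_nat leqW// leq_max leqnn orbT.
    apply: le_trans (hC w r _ wx); last by rewrite r0.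
    rewrite lerD2l lerN2 ler_wpM2r ?exprn_ge0 ?(ltW r0)//.
    rewrite ltW// (lt_le_trans (archi_boundP C0))//.
    by rewrite ler_nat leq_max leqnn.
  move=> k; pose K := k%:R + n%:R * n%:R ^+ m * N%:R : R.
  have K0 : 0 <= K by rewrite addr_ge0// !mulr_ge0// exprn_ge0.
  apply: (@flat_image_null R n _ _ c f I n K k.+1%:R^-1) => //.
  + by rewrite cardI.
  + by move=> x _; exact: suppT.
  (* The lower bound at [x] is evaluated at [c x'], where flatness replaces the polynomial by its
     value [f x]. Exchanging [x] and [x'] gives the other side. *)
  have one x x' r : (B `&` [set x | forall w r, 0 < r <= k.+1%:R^-1 ->
      sup_close r w (c x) -> meval w (P x) - k%:R * r ^+ n <= f (rowv w)]) x ->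
      0 < r <= k.+1%:R^-1 -> sup_close r (c x') (c x) -> f x - f x' <= K * r ^+ n.
    move=> [[Ax [st MP]] low] /andP[r0 rk] xx'.
    have := low (c x') r; rewrite r0 rk coordsK => /(_ isT xx') h1.
    have r1 : r <= 1 by rewrite (le_trans rk)// invf_le1// ler1n.
    have := @stationary_bound R n I (P x) (c x) N%:R m (c x') r.
    rewrite (ltW r0) r1 ler0n => /(_ isT isT (suppT _) (suppT _) xx' MP st).
    have [-> _ _ _] := hP _ Ax.
    have -> : n%:R * (r * ((n%:R * r) ^+ m * N%:R)) = n%:R * n%:R ^+ m * N%:R * r ^+ n.
      by rewrite exprMn exprS; ring.
    rewrite ler_norml => /andP[h2 _]; rewrite /K mulrDl; lra.
  move=> x x' r Bx Bx' rk xx'; rewrite ler_norml; apply/andP; split.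
    by rewrite lerNl opprB; apply: one => //.
  by apply: one => //; exact: sup_close_sym.
set B := A `&` _.
have [->|/set0P[x0 [_ [/andP[/andP[bI jI] /andP[b0 bs]] _ _ _ _]]]] := eqVneq B set0.
  by rewrite image_set0 lom0.
pose q := (m - (size b).+1)%N; have mE : (q.+1 + size b)%N = m.
  by rewrite /q addSn -addnS subnK.
(* For [m = 1] this stratum is empty; a point in it thus yields the bound that [jet_sardP]
   requires. *)
have m2 : (2 <= m)%N by exact: leq_ltn_trans bs.
have [C C0 hC] := @compat_dword R n 'rV[R]_n N q.+1 (size b).
pose c0 : R := N.+1%:R^-1; have c00 : 0 < c0 by rewrite invr_gt0.
(* When [size b] is maximal, the gradient [c0] of the derivative along [b]
   competes with a Taylor remainder of the same order, so the latter has to be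
   made small with respect to [c0]. *)
pose e := c0 / 8 / (C + 1).
have C1 : 0 < C + 1 by rewrite ltr_wpDl.
have e0 : 0 < e by rewrite !divr_gt0.
apply: (@lom_null_cover R nat _ B f (fun k => [set x | forall w r, 0 < r <= k.+1%:R^-1 ->
    sup_close r w (c x) -> `|f (rowv w) - meval w (P x)| <= e * r ^+ m])).
  move=> x [/hP[_ /(_ _ e0)[d d0 hd] _ _] _].
  exists (Num.Def.archi_bound d^-1) => w r /andP[r0 rk] wx; apply: hd => //.
  rewrite r0 (le_trans rk)// -[leRHS]invrK lef_pV2 ?posrE ?invr_gt0//.
  rewrite ltW// (lt_le_trans (archi_boundP _)) ?invr_ge0 ?(ltW d0)//.
  by rewrite ler_nat.
move=> k; set B' := B `&` _.
pose d : R := k.+1%:R^-1; have d0 : 0 < d by rewrite invr_gt0.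
have cB : compat B' c I P (q.+1 + size b) (2 * e) d.
  rewrite mE => x x' [_ hx] [_ hx'] w r _ rd wx wx'.
  rewrite (le_trans (ler_distD (f (rowv w)) _ _))//.
  rewrite -mulrA mulr_natl mulr2n lerD//; last exact: hx'.
  by rewrite distrC; exact: hx.
have cG : compat B' c I (fun x => dword b (P x)) q.+1 (C * (2 * e)) (d / 2 ^+ size b).
  by apply: hC => //; [rewrite mulr_ge0// ltW|move=> x [[_ []]]].
have Ce : C * (2 * e) <= c0 / 4.
  have -> : C * (2 * e) = c0 / 4 * (C / (C + 1)) by rewrite /e; field; rewrite gt_eqF.
  by rewrite ler_piMr ?divr_ge0 ?(ltW c00)// ler_pdivrMr// mul1r lerDl.
pose eta := Num.min (d / 2 ^+ size b) 1.
have eta0 : 0 < eta by rewrite lt_min ltr01 divr_gt0// exprn_gt0.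
apply: (@nonflat_null R n _ B' c I P f b j N%:R c0 (2 * e) d eta N q) => //.
- rewrite mE; apply: jet_sardP => //.
  by have := cardsD1 j I; rewrite jI cardI add1n => -[<-].
- by rewrite mulr_ge0// ltW.
- by move=> x [[_ [_ ? ? ? ?]] _]; split => //; exact: suppT.
- by move=> x [[/hP[]]].
move=> x x' r Bx Bx' /andP[r0]; rewrite le_min => /andP[rd r1] xx'.
have [[Ax' [_ _ _ _ [Gx' _]]] _] := Bx'.
rewrite -[meval _ _]subr0 -Gx'.
apply: (@le_trans _ _ (C * (2 * e) * r ^+ q.+1)).
  apply: cG => //; first exact: suppT.
  - by rewrite r0.
  - exact: sup_close_sym.
  - exact: sup_close_refl (ltW r0).
apply: ler_pM => //; rewrite ?exprn_ge0 ?(ltW r0)//; first by rewrite mulr_ge0// mulr_ge0// ltW.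
by rewrite exprS ler_piMr ?(ltW r0)// exprn_ile1 ?(ltW r0).
Qed.

End MorseSard.

Unset Implicit Arguments.

Theorem theorem1p6 (R : realType) (n : nat) (hn : (2 <= n)%N) :
  (forall f : 'rV[R]_n -> R,
     lebesgue_outer_measure (f @` subdiff_critical n f) = 0%E) /\
  (forall (U : set 'rV[R]_n) (f : U -> R), open U ->
     lebesgue_outer_measure (f @` subdiff_critical_on n f) = 0%E).
Proof.
case: n hn => // m m1.
split=> [f|U f _]; first exact: subdiff_critical_image_null.
apply/eqP; rewrite eq_le lom_ge0 andbT.
(* The image lies in that of the extension by 0, which agrees with [f] on [U]. *)
rewrite -(@subdiff_critical_image_null R m ('valL_0 f) m1).
apply: le_lom => _ [u Cu <-]; exists (val u) => //.
exact: (congr1 (fun g => g u) (valLK 0 f)).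
Qed.
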